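(* (Discrete Poincaré–Wirtinger median inequality.) Let $\Omega$ be an open bounded connected polyhedral domain of $\mathbb{R}^d$, $d\ge2$, and let $\mathcal M$ be an admissible mesh of $\Omega$ satisfying, for some $\xi>0$, $d(x_K,\sigma)\ge\xi d_\sigma$ for all $K\in\mathcal T$ and $\sigma\in\mathcal E_K$. Then for $1\le p<+\infty$ there exists a constant $C>0$ depending only on $\Omega$, $d$ and $p$ such that $$\|u-c\|_{0,p}\le\frac{C}{\xi^{(p-1)/p}}\,|u|_{1,p,\mathcal M}\qquad\forall u\in X(\mathcal T),$$ where $c$ is any element of $\mathrm{med}(u)$.
   Context: Admissible mesh: an admissible mesh $\mathcal M$ of $\Omega$ is given by a finite family $\mathcal T$ of disjoint open convex polygonal subsets of $\Omega$ (control volumes), a finite family $\mathcal E$ of disjoint subsets of $\overline\Omega$ (edges) which are non-empty open convex subsets of affine hyperplanes, and a family of points $(x_K)_{K\in\mathcal T}$ in $\Omega$ such that: $\overline\Omega=\bigcup_{K}\overline K$; each $\sigma\in\mathcal E$ is a non-empty open subset of $\partial K$ for some $K\in\mathcal T$; with $\mathcal E_K=\{\sigma\in\mathcal E:\sigma\subset\partial K\}$, $\partial K=\bigcup_{\sigma\in\mathcal E_K}\overline\sigma$; for $K\ne L$ in $\mathcal T$, either $\overline K\cap\overline L$ has zero $(d-1)$-dimensional measure or $\overline K\cap\overline L=\overline\sigma$ for some $\sigma\in\mathcal E$, then denoted $\sigma=K|L$; $x_K\in K$ for all $K$; for all $\sigma=K|L$, the straight line $(x_K,x_L)$ intersects and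 is orthogonal to $\sigma$; for all $\sigma\subset\partial\Omega\cap\partial K$, the line through $x_K$ orthogonal to $\sigma$ intersects $\sigma$. Notation: $\mathcal E_{int}$, $\mathcal E_{ext}$ are the sets of interior and boundary edges; $\mathrm m(K)$, $\mathrm m(\sigma)$ are the $d$- and $(d-1)$-dimensional measures; $d_{K,\sigma}=d(x_K,\sigma)$ is the Euclidean distance; $d_\sigma=|x_K-x_L|$ if $\sigma=K|L$, and $d_\sigma=d_{K,\sigma}$ if $\sigma\in\mathcal E_{ext}\cap\mathcal E_K$. $X(\mathcal T)$ is the set of functions $\Omega\to\mathbb{R}$ constant on each control volume, $u=(u_K)_{K\in\mathcal T}$. Norms: $\|u\|_{0,p}=\big(\sum_{K\in\mathcal T}\mathrm m(K)|u_K|^p\big)^{1/p}$ and $|u|_{1,p,\mathcal M}=\Big(\sum_{\sigma=K|L\in\mathcal E_{int}}\frac{\mathrm m(\sigma)}{d_\sigma^{p-1}}|u_K-u_L|^p\Big)^{1/p}$. $\mathrm{med}(u)$ is the set of $t\in\mathbb{R}$ such that $\mathrm{meas}\{x\in\Omega:u(x)>t\}\le\mathrm{meas}(\Omega)/2$ and $\mathrm{meas}\{x\in\Omega:u(x)<t\}\le\mathrm{meas}(\Omega)/2$. *)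

(* Defs.v *)
From HB Require Import structures.
From mathcomp Require Import all_boot all_order all_algebra.
From mathcomp Require Import all_classical all_reals all_analysis.

Set Implicit Arguments.
Unset Strict Implicit.
Unset Printing Implicit Defensive.

Import Order.TTheory GRing.Theory Num.Theory.
Import numFieldNormedType.Exports.

Local Open Scope classical_set_scope.
Local Open Scope ring_scope.

Definition tuple_cons (T : Type) (n : nat) (x : T * n.-tuple T) : n.+1.-tuple T :=
  [tuple of x.1 :: x.2].

Section cons_product.
Context d (T : measurableType d) (R : realType) (n : nat).
Context (m1 : {sigma_finite_measure set T -> \bar R}).
Context (m2 : {sigma_finite_measure set (n.-tuple T) -> \bar R}).

Definition cons_product : set (n.+1.-tuple T) -> \bar R :=
  pushforward (m1 \x m2)%E (@tuple_cons T n).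

Let measurable_tuple_cons : measurable_fun setT (@tuple_cons T n).
Proof. exact: measurable_cons. Qed.

HB.instance Definition _ :=
  isMeasurableFun.Build _ _ _ _ (@tuple_cons T n) measurable_tuple_cons.

Let cons_product0 : cons_product set0 = 0%E.
Proof. exact: measure0. Qed.

Let cons_product_ge0 A : (0 <= cons_product A)%E.
Proof. exact: measure_ge0. Qed.

Let cons_product_sigma_additive : semi_sigma_additive cons_product.
Proof. exact: measure_semi_sigma_additive. Qed.

HB.instance Definition _ := isMeasure.Build _ _ _ cons_product
  cons_product0 cons_product_ge0 cons_product_sigma_additive.

Let cons_product_sigma_finite : sigma_finite setT cons_product.
Proof.
have /sigma_finiteP[F [TF ndF Foo]] := sigma_finiteT m1.
have /sigma_finiteP[G [TG ndG Goo]] := sigma_finiteT m2.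
pose g (t : n.+1.-tuple T) := (thead t, [tuple of behead t]).
have mg : measurable_fun setT g.
  by apply/measurable_fun_pairP; split;
    [exact: measurable_tnth|exact: measurable_behead].
exists (fun k => g @^-1` (F k `*` G k)) => [|k].
  apply/esym; rewrite -subTset => t _.
  have [i _ Fi] : (\bigcup_n F n) (thead t) by rewrite -TF.
  have [j _ Gj] : (\bigcup_n G n) [tuple of behead t] by rewrite -TG.
  exists (maxn i j) => //; split => /=.
  - by move: Fi; exact/subsetPset/ndF/leq_maxl.
  - by move: Gj; exact/subsetPset/ndG/leq_maxr.
have [mF Fk] := Foo k; have [mG Gk] := Goo k; split.
  by rewrite -[X in measurable X]setTI; apply: mg => //; exact: measurableX.
rewrite /cons_product /pushforward (_ : _ @^-1` _ = F k `*` G k).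
  by rewrite product_measure1E// lte_mul_pinfty// ge0_fin_numE.
apply/seteqP; split=> -[x t] /=; rewrite /g /tuple_cons theadE /=.
all: by rewrite (_ : [tuple of _] = t)//; exact: val_inj.
Qed.

HB.instance Definition _ := Measure_isSigmaFinite.Build _ _ _ cons_product
  cons_product_sigma_finite.

End cons_product.

Fixpoint lebesgue_tuple (R : realType) (n : nat) :
    {sigma_finite_measure set (n.-tuple (measurableTypeR R)) -> \bar R} :=
  match n with
  | 0 => \d_[tuple]
  | n'.+1 => cons_product (@lebesgue_measure R) (lebesgue_tuple R n')
  end.

(* The outer measure induced by the product measure: it agrees with it on Borel
   sets and with its completion on Lebesgue measurable sets. *)
Definition lebesgue (R : realType) (n : nat) (A : set 'rV[R]_n) : \bar R :=
  mu_ext (lebesgue_tuple R n)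
    [set t : n.-tuple (measurableTypeR R) | A (\row_i tnth t i)].

Definition dot (R : realType) (n : nat) (x y : 'rV[R]_n) : R :=
  \sum_i x 0 i * y 0 i.

(* The library norm on row vectors is the sup norm; only the topology and
   boundedness, which are the Euclidean ones, are taken from it. *)
Definition enorm (R : realType) (n : nat) (x : 'rV[R]_n) : R :=
  Num.sqrt (dot x x).

Definition edist (R : realType) (n : nat) (x : 'rV[R]_n) (A : set 'rV[R]_n) : R :=
  inf [set enorm (x - y) | y in A].

Definition orthogonal_to (R : realType) (n : nat) (v : 'rV[R]_n)
    (A : set 'rV[R]_n) : Prop :=
  forall y z, A y -> A z -> dot v (y - z) = 0.

Definition line (R : realType) (n : nat) (x v : 'rV[R]_n) : set 'rV[R]_n :=
  [set x + t *: v | t in [set: R]].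

Definition hyperplane (R : realType) (n : nat) (v : 'rV[R]_n) (b : R) :
    set 'rV[R]_n :=
  [set x | dot v x = b].

(* (d-1)-dimensional Lebesgue measure of a subset A of an affine hyperplane of
   R^d: the Lebesgue measure of A read through an isometry
   s |-> a + s *m V (V with orthonormal rows) from R^(d-1) onto a hyperplane
   containing A.  By invariance of the Lebesgue measure under isometries the
   value does not depend on (a, V), so that the infimum is over a constant
   family; it is +oo when no hyperplane contains A. *)
Definition surface_measure (R : realType) (d : nat) (A : set 'rV[R]_d) : \bar R :=
  ereal_inf [set m | exists (a : 'rV[R]_d) (V : 'M[R]_(d.-1, d)),
    [/\ V *m V^T = 1%:M,
        A `<=` [set a + s *m V | s in [set: 'rV[R]_d.-1]] &
        m = lebesgue [set s : 'rV[R]_d.-1 | A (a + s *m V)]]].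

Definition boundary (T : topologicalType) (A : set T) : set T :=
  closure A `\` interior A.

(* The boundary lies in finitely many affine hyperplanes; for a bounded open
   convex set this says that it is the interior of a convex polytope. *)
Definition polyhedral (R : realType) (d : nat) (A : set 'rV[R]_d) : Prop :=
  exists s : seq ('rV[R]_d * R),
    (forall h, h \in s -> h.1 != 0) /\
    boundary A `<=` [set x | exists2 h, h \in s & hyperplane h.1 h.2 x].

Record mesh (R : realType) (d : nat) := Mesh {
  cell : finType;
  edge : finType;
  volume : cell -> set 'rV[R]_d;
  face : edge -> set 'rV[R]_d;
  center : cell -> 'rV[R]_d }.

Section mesh_notions.
Context (R : realType) (d : nat) (Omega : set 'rV[R]_d) (M : mesh R d).
Implicit Types (s : edge M) (K L : cell M) (u : 'rV[R]_d -> R).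

(* s \in E_K *)
Definition edge_of K s : Prop := face s `<=` boundary (volume K).

(* s = K|L *)
Definition interface s K L : Prop :=
  K != L /\ closure (volume K) `&` closure (volume L) = closure (face s).

Definition exterior_edge s : Prop := face s `<=` boundary Omega.

Definition interior_edge s : Prop := ~ exterior_edge s.

Record admissible : Prop := Admissible {
  volume_disjoint : trivIset setT (@volume R d M);
  volume_open : forall K, open (volume K);
  volume_convex : forall K, @convex_set R 'rV[R]_d (volume K);
  volume_polyhedral : forall K, polyhedral (volume K);
  volume_sub : forall K, volume K `<=` Omega;
  face_disjoint : trivIset setT (@face R d M);
  face_sub : forall s, face s `<=` closure Omega;
  face_nonempty : forall s, face s !=set0;
  face_convex : forall s, @convex_set R 'rV[R]_d (face s);
  face_hyperplane : forall s, exists (v : 'rV[R]_d) (b : R) (U : set 'rV[R]_d),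
    [/\ v != 0, open U & face s = hyperplane v b `&` U];
  center_in_domain : forall K, Omega (center K);
  closure_cover : closure Omega = \bigcup_(K in [set: cell M]) closure (volume K);
  face_open_in_boundary : forall s, exists (K : cell M) (U : set 'rV[R]_d),
    open U /\ face s = boundary (volume K) `&` U;
  boundary_cover : forall K,
    boundary (volume K) = \bigcup_(s in edge_of K) closure (face s);
  volume_intersection : forall K L, K != L ->
    surface_measure (closure (volume K) `&` closure (volume L)) = 0%E \/
    exists s, closure (volume K) `&` closure (volume L) = closure (face s);
  center_in_volume : forall K, volume K (center K);
  interface_orthogonal : forall s K L, interface s K L ->
    (line (center K) (center L - center K) `&` face s !=set0) /\
    orthogonal_to (center L - center K) (face s);
  exterior_orthogonal : forall s K, exterior_edge s -> edge_of K s ->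
    exists v : 'rV[R]_d, [/\ v != 0, orthogonal_to v (face s) &
      line (center K) v `&` face s !=set0] }.

(* A pair (K, L) with s = K|L, if any.  In an admissible mesh it is unique up to
   order, and everything below is symmetric in K and L. *)
Definition sides s : option (cell M * cell M) :=
  [pick KL : cell M * cell M | `[< interface s KL.1 KL.2 >]].

(* d_s; the argument K is only relevant when s is not of the form K|L. *)
Definition d_edge K s : R :=
  if sides s is Some KL then enorm (center KL.1 - center KL.2)
  else edist (center K) (face s).

Definition regular (xi : R) : Prop :=
  forall K s, edge_of K s -> xi * d_edge K s <= edist (center K) (face s).

(* Only the values of u on Omega matter in the notions below. *)
Definition piecewise_constant u : Prop :=
  forall K x y, volume K x -> volume K y -> u x = u y.

(* For piecewise constant u, the value u_K is u (center K). *)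
Definition norm0 (p : R) u : R :=
  (\sum_(K : cell M) fine (lebesgue (volume K)) * `|u (center K)| `^ p) `^ p^-1.

Definition seminorm1 (p : R) u : R :=
  (\sum_(s : edge M | `[< interior_edge s >])
    if sides s is Some KL then
      fine (surface_measure (face s)) / d_edge KL.1 s `^ (p - 1) *
      `|u (center KL.1) - u (center KL.2)| `^ p
    else 0) `^ p^-1.

Definition med u : set R := [set t : R |
  (lebesgue [set x | Omega x /\ (t < u x)%R] <= lebesgue Omega * (2^-1)%R%:E)%E /\
  (lebesgue [set x | Omega x /\ (u x < t)%R] <= lebesgue Omega * (2^-1)%R%:E)%E].

End mesh_notions.

(* Main.v *)
Require Import Defs.
From mathcomp Require Import all_boot all_order all_algebra.
From mathcomp Require Import all_classical all_reals all_analysis.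
From mathcomp Require Import measurable_realfun.
From mathcomp Require Import ring lra.
Import Order.TTheory GRing.Theory Num.Theory.
Import numFieldNormedType.Exports.
Import Defs.

(** The inequality comes from its case p = 1, applied to a power of u - c.

    Case p = 1.  Let v be constant on the cells, with 0 as a median.  A median
    minimises the L1 distance to the constants ([median_minimizes]), so that
    vol(Omega) times the L1 norm of v is at most the integral of
    |v(x) - v(y)| over Omega x Omega, which [oscillation] writes as a sum over
    pairs of cells.  This double integral has to be bounded by a constant of
    Omega times [jumps], the sum over the interfaces K|L of
    m(K|L) |v_K - v_L| ([poincare_median]).
    - On a convex open D inside Omega, write y = x + h.  The segment from x to
      x + h stays in Omega, hence is covered by the closures of the cells;
      because a segment is connected, |v(x) - v(x + h)| is at most the sum of
      |v_K - v_L| over the pairs of cells whose closures share a point of the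
      segment ([segment_jumps]).  For fixed h, the points x whose segment
      meets a flat piece F of normal e lie in an oblique prism of volume at
      most |h.e| m(F) ([lebesgue_sweep]).  Integrating over the bounded set of
      all h gives the bound on D x D ([convex_jumps]).
    - The bound on A x B and the bound on B x E give the one on A x E, by the
      triangle inequality through the points of B ([linked_trans]).  Since
      Omega is connected, it holds on products of small balls around any two
      points ([linked_balls]), hence on products of any two convex open
      subsets.  The hyperplanes that carry the boundary of Omega cut Omega, up
      to a null set, into finitely many convex open sets, which gives the
      bound on Omega x Omega ([linked_domain]).  The mesh enters none of the
      constants.

    General p.  Put w = u - c and v = sgn(w) |w|^p, which still has 0 as a
    median.  Then |v_K - v_L| <= p (|w_K|^(p-1) + |w_L|^(p-1)) |w_K - w_L|, and
    Young's inequality with a weight eta ([jumps_young]) bounds [jumps] of v,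
    up to factors that depend on p, by the sum of
    - eta times the sum of m(s) d_s (|w_K|^p + |w_L|^p) over the faces s = K|L,
      and
    - eta^(1-p) times the p-th power of the seminorm of u.
    Regularity replaces d_s by d(x_K, s) / xi, and the pyramids with apex x_K
    over the faces of K are disjoint subsets of K, so that the sum of
    m(s) d(x_K, s) over these faces is at most a multiple of vol(K)
    ([sum_pyramids]).  Hence the first term is at most a multiple of eta / xi
    times the p-th power of the norm of w, and is absorbed in the left-hand
    side when eta is a small multiple of xi.  The second term is then a
    multiple of xi^(1-p), whence the power of xi in the statement
    ([poincare_power]).

    Measure theory.  The volume is a product measure, so its invariance under
    translations is an induction on the dimension.  Computing the volume of
    one set of pairs by its two families of sections yields
    vol(Q^-1 A) vol(B) = vol(A) vol(Q^-1 B) for invertible Q and symmetric B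
    ([lebesgue_unitmx]); the Euclidean ball as B gives invariance under
    orthogonal maps, a cube gives the effect of dilations.  Orthonormal frames
    then reduce prisms and pyramids to their slices.  The surface measure is an
    infimum over orthonormal charts: volumes are bounded above by the measure
    read in every chart, and below by the measure read in one of them. *)

Set Implicit Arguments.
Unset Strict Implicit.
Unset Printing Implicit Defensive.

Local Open Scope classical_set_scope.
Local Open Scope ring_scope.

(** * Product measures and their sections *)

(** Keeps a pushforward as a measure known only through its values: the
    measure structure of [pushforward] depends on the measurability proof. *)
Lemma pushforward_measure d1 d2 (T1 : measurableType d1)
    (T2 : measurableType d2) (R : realType) (f : T1 -> T2)
    (mu : {measure set T1 -> \bar R}) : measurable_fun setT f ->
  exists nu : {measure set T2 -> \bar R}, forall X, nu X = mu (f @^-1` X).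
Proof.
by move=> mf; exists (pushforward mu f).
Unshelve. exact: mf. Qed.

Lemma measure_cst_indic d (T : measurableType d) (R : realType)
    (m : {measure set T -> \bar R}) (J : set T) (c : \bar R) :
  measurable J -> (0 <= c)%E ->
  (\int[m]_x (c * (\1_J x)%:E) = c * m J)%E.
Proof.
move=> mJ c0; rewrite ge0_integralZl//; first by rewrite integral_indic// setIT.
exact/measurable_EFinP.
Qed.

Section product_sections.
Local Open Scope ereal_scope.
Context d1 d2 (T1 : measurableType d1) (T2 : measurableType d2) (R : realType).
Variable m1 : {sigma_finite_measure set T1 -> \bar R}.
Variable m2 : {sigma_finite_measure set T2 -> \bar R}.
Implicit Types (E : set (T1 * T2)) (J : set T1) (c : \bar R).

Lemma product_measure_sections E J c : measurable E -> measurable J -> 0 <= c ->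
  (forall x, m2 (xsection E x) = c * (\1_J x)%:E) -> (m1 \x m2) E = c * m1 J.
Proof.
move=> mE mJ c0 Ec; rewrite -measure_cst_indic//.
by apply: eq_integral => x _; exact: Ec.
Qed.

Lemma product_measure_le_sections E J c : measurable E -> measurable J ->
  0 <= c -> (forall x, m2 (xsection E x) <= c * (\1_J x)%:E) ->
  (m1 \x m2) E <= c * m1 J.
Proof.
move=> mE mJ c0 Ec; rewrite -measure_cst_indic//; apply: ge0_le_integral => //.
- exact: measurable_fun_xsection.
- by apply: measurable_funeM; exact/measurable_EFinP.
- by move=> x _; exact: Ec.
Qed.

Lemma product_measure_ge_sections E J c : measurable E -> measurable J ->
  0 <= c -> (forall x, c * (\1_J x)%:E <= m2 (xsection E x)) ->
  c * m1 J <= (m1 \x m2) E.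
Proof.
move=> mE mJ c0 Ec; rewrite -measure_cst_indic//; apply: ge0_le_integral => //.
- by move=> x _; rewrite mule_ge0// lee_fin.
- by apply: measurable_funeM; exact/measurable_EFinP.
- exact: measurable_fun_xsection.
Qed.

(** The product measure is unique, hence equal to the one that is defined by
    integrating in the other order. *)
Lemma product_measure_ysections E : measurable E ->
  (m1 \x m2) E = \int[m2]_y m1 (ysection E y).
Proof.
move=> mE; rewrite (@product_measure_unique _ _ _ _ _ m1 m2 (m1 \x^ m2)%E)//.
by move=> A B mA mB; exact: product_measure2E.
Qed.

Lemma product_measure_le_ysections E (J : set T2) c :
  measurable E -> measurable J -> 0 <= c ->
  (forall y, m1 (ysection E y) <= c * (\1_J y)%:E) ->
  (m1 \x m2) E <= c * m2 J.
Proof.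
move=> mE mJ c0 Ec; rewrite product_measure_ysections//.
rewrite -measure_cst_indic//; apply: ge0_le_integral => //.
- exact: measurable_fun_ysection.
- by apply: measurable_funeM; exact/measurable_EFinP.
Qed.

End product_sections.

(** * Borel sets and translations *)

Section tuples.
Context (R : realType).

Definition row_of n (t : n.-tuple (measurableTypeR R)) : 'rV[R]_n :=
  \row_i tnth t i.

Definition tuple_of n (x : 'rV[R]_n) : n.-tuple (measurableTypeR R) :=
  [tuple x 0 i | i < n].

Lemma tuple_ofK n : cancel (@tuple_of n) (@row_of n).
Proof. by move=> x; apply/rowP => i; rewrite mxE tnth_mktuple. Qed.

(** The measurable structure lives on tuples; sets of row vectors are read
    through [row_of]. *)
Definition borel n (A : set 'rV[R]_n) := measurable (@row_of n @^-1` A).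

Lemma lebesgueE n (A : set 'rV[R]_n) : borel A ->
  lebesgue A = lebesgue_tuple R n (@row_of n @^-1` A).
Proof. by move=> mA; rewrite /lebesgue measurable_mu_extE. Qed.

Lemma borel_comp d (T : measurableType d) n (f : T -> 'rV[R]_n) A :
  (forall i, measurable_fun setT (fun x => f x 0 i : measurableTypeR R)) ->
  borel A -> measurable (f @^-1` A).
Proof.
move=> mf mA.
rewrite (_ : _ @^-1` _ = setT `&` (@tuple_of n \o f) @^-1` (@row_of n @^-1` A)).
  suff /(_ measurableT _ mA) : measurable_fun setT (@tuple_of n \o f) by [].
  apply/measurable_fun_tnthP => i.
    rewrite (_ : _ \o _ = fun x => f x 0 i)//.
    by apply/funext => x /=; rewrite tnth_mktuple.
by rewrite setTI; apply/seteqP; split=> x /=; rewrite tuple_ofK.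
Qed.

Lemma measurable_row_of n i :
  measurable_fun setT (fun t => @row_of n t 0 i : measurableTypeR R).
Proof.
rewrite (_ : (fun _ => _) = @tnth n (measurableTypeR R) ^~ i).
  exact: measurable_tnth.
by apply/funext => x; rewrite mxE.
Qed.

Lemma borel_preimage n m (f : 'rV[R]_n -> 'rV[R]_m) A :
  (forall i, measurable_fun setT
     (fun t => f (@row_of n t) 0 i : measurableTypeR R)) ->
  borel A -> borel (f @^-1` A).
Proof. by move=> mf mA; exact: (@borel_comp _ _ m (f \o @row_of n)). Qed.

Lemma borelI n (A B : set 'rV[R]_n) : borel A -> borel B -> borel (A `&` B).
Proof. exact: measurableI. Qed.

Lemma borelC n (A : set 'rV[R]_n) : borel A -> borel (~` A).
Proof. exact: measurableC. Qed.

Lemma ball_rowP n (x y : 'rV[R]_n) (r : R) : 0 < r ->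
  ball x r y <-> forall i, `|x 0 i - y 0 i| < r.
Proof.
move=> r0; split=> [[_ h] i|h]; first exact: h.
by split=> // i j; rewrite ord1; exact: h.
Qed.

Lemma borel_ball n (x : 'rV[R]_n) (r : R) : borel (ball x r).
Proof.
have [r0|r0] := ltP 0 r; last first.
  rewrite (_ : ball x r = set0); first by rewrite /borel preimage_set0.
  by rewrite -subset0 => y [/lt_le_trans/(_ r0)]; rewrite ltxx.
rewrite (_ : ball x r = \bigcap_(i in [set: 'I_n])
    [set y : 'rV_n | y 0 i \in `]x 0 i - r, x 0 i + r[]).
  rewrite /borel preimage_bigcap.
  apply: (@fin_bigcap_measurable _ (n.-tuple (measurableTypeR R))) => [|i _].
    exact: finite_finset.
  have := @measurable_row_of n i measurableT
    _ (measurable_itv (`]x 0 i - r, x 0 i + r[)).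
  by rewrite setTI.
apply/seteqP; split => y.
  move/(ball_rowP _ _ r0) => h i _ /=; move: (h i).
  by rewrite in_itv/= ltr_norml; lra.
move=> h; apply/ball_rowP => // i; have := h i I.
by rewrite /= in_itv/= ltr_norml; lra.
Qed.

(** An open set is the union of the balls that it contains among the countably
    many with rational centre and radius 1 / (k + 1). *)
Lemma borel_open n (A : set 'rV[R]_n) : open A -> borel A.
Proof.
move=> oA.
pose q (k : 'rV[rat]_n * nat) : set 'rV[R]_n :=
  ball (map_mx (ratr : rat -> R) k.1) k.2.+1%:R^-1.
rewrite (_ : A = \bigcup_(k in [set k | q k `<=` A]) q k).
  rewrite /borel preimage_bigcup bigcup_mkcond.
  apply: (@countable_bigcupT_measurable _ (n.-tuple (measurableTypeR R))) => [|k].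
    exact: countableP.
  by case: ifP => _; [exact: borel_ball|exact: measurable0].
apply/seteqP; split => [x Ax|x [k kA]]; last exact: kA.
have /nbhs_ballP[e/= e0 xe] : nbhs x A by exact: oA.
have [m me] : exists m : nat, m.+1%:R^-1 < e / 2.
  have [m] := @ltr_add_invr R 0 (e / 2) ltac:(lra).
  by rewrite add0r => ?; exists m.
have m0 : 0 < m.+1%:R^-1 :> R by rewrite invr_gt0.
have /choice[f fP] : forall i, exists p : rat, `|ratr p - x 0 i| < m.+1%:R^-1.
  move=> i; set d := m.+1%:R^-1 in m0 *.
  have xd : x 0 i - d < x 0 i + d by lra.
  have [p] := rat_in_itvoo xd.
  by rewrite in_itv/= => ?; exists p; rewrite ltr_norml; lra.
exists (\row_i f i, m) => /=; last first.
  by apply/ball_rowP => // i; rewrite !mxE.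
move=> y /(ball_rowP _ _ m0) h; apply: xe; apply/ball_rowP => // i.
have := h i; have := fP i; rewrite !mxE /= !ltr_norml.
by set d := m.+1%:R^-1 in me *; lra.
Qed.

Lemma borel_closed n (A : set 'rV[R]_n) : closed A -> borel A.
Proof.
by move=> cA; rewrite -[A]setCK; apply: borelC; apply: borel_open; exact: closed_openC.
Qed.

Lemma lebesgue_measure_shift (a : R) (A : set (measurableTypeR R)) :
  measurable A ->
  lebesgue_measure [set x : R | A (x + a)] = lebesgue_measure A.
Proof.
have mf : measurable_fun setT ((fun x : R => x + a) :
    measurableTypeR R -> measurableTypeR R).
  exact: measurable_funD.
have [mu muE] := pushforward_measure (@lebesgue_measure R) mf.
move=> mA; rewrite -[LHS](muE A); apply/esym.
apply: lebesgue_measure_unique => // X [[u v] _ <-] /=.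
rewrite muE (_ : _ @^-1` _ = `]u - a, v - a]%classic).
  have E (p q : R) :
      lebesgue_measure `]p, q]%classic = if p < q then (q - p)%:E else 0%E.
    by rewrite lebesgue_measure_itv /= lte_fin -EFinD.
  rewrite [LHS]E [RHS]E (_ : (u - a < v - a) = (u < v)) ?ltrD2r//.
  by congr (if _ then _ else _); congr EFin; ring.
by apply/seteqP; split => x /=; rewrite !in_itv/=; lra.
Qed.

Definition tuple_add n (h : 'I_n -> R) (t : n.-tuple (measurableTypeR R)) :
  n.-tuple (measurableTypeR R) := [tuple tnth t i + h i | i < n].

Lemma measurable_tuple_add n h : measurable_fun setT (@tuple_add n h).
Proof.
apply/measurable_fun_tnthP => i.
rewrite (_ : _ \o _ = fun t => tnth t i + h i).
  by apply: measurable_funD => //; exact: measurable_tnth.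
by apply/funext => t /=; rewrite tnth_mktuple.
Qed.

Lemma measurable_tuple_cons n :
  measurable_fun setT (@tuple_cons (measurableTypeR R) n).
Proof. exact: measurable_cons. Qed.

(** By induction on the dimension: the translate of the measure agrees with the
    product measure on rectangles, hence everywhere. *)
Lemma lebesgue_tuple_shift n (h : 'I_n -> R) E : measurable E ->
  lebesgue_tuple R n (tuple_add h @^-1` E) = lebesgue_tuple R n E.
Proof.
elim: n h E => [|n IH] h E mE.
  rewrite (_ : tuple_add h @^-1` E = E)//; apply/seteqP.
  by split=> t /=; rewrite (_ : tuple_add h t = t)//; apply: eq_from_tnth => -[].
pose h' i := h (lift ord0 i).
have mf : measurable_fun setT ((fun z => (z.1 + h ord0, tuple_add h' z.2)) :
    measurableTypeR R * n.-tuple (measurableTypeR R) ->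
    measurableTypeR R * n.-tuple (measurableTypeR R)).
  apply/measurable_fun_pairP; split.
    by apply: measurable_funD => //; exact: measurable_fst.
  by apply: (measurableT_comp (measurable_tuple_add h')); exact: measurable_snd.
pose mu := (@lebesgue_measure R \x lebesgue_tuple R n)%E.
have [nu nuE] := pushforward_measure mu mf.
have mE' : measurable (@tuple_cons (measurableTypeR R) n @^-1` E).
  by rewrite -[X in measurable X]setTI; exact: measurable_tuple_cons.
have := @product_measure_unique _ _ _ _ _ (@lebesgue_measure R)
  (lebesgue_tuple R n) nu _ _ mE'.
rewrite /= /cons_product /pushforward /= => ->.
  rewrite nuE; congr (mu _); apply/seteqP; split=> -[x t] /=.
    rewrite /tuple_cons /=; congr (E _); apply: eq_from_tnth => i.
    rewrite tnth_mktuple; case: (unliftP ord0 i) => [j ->|->].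
      by rewrite !tnthS tnth_mktuple.
    by rewrite !tnth0.
  rewrite /tuple_cons /=; congr (E _); apply: eq_from_tnth => i.
  rewrite tnth_mktuple; case: (unliftP ord0 i) => [j ->|->].
    by rewrite !tnthS tnth_mktuple.
  by rewrite !tnth0.
move=> A B mA mB; rewrite nuE.
rewrite (_ : _ @^-1` _ = [set x : R | A (x + h ord0)] `*` (tuple_add h' @^-1` B))//.
rewrite -(lebesgue_measure_shift (h ord0) mA) -(IH h' _ mB).
apply: product_measure1E.
- have := @measurable_funD _ (measurableTypeR R) R setT id (cst (h ord0)).
  by move=> /(_ _ _ measurableT _ mA); rewrite setTI; exact.
- by rewrite -[X in measurable X]setTI; exact: (measurable_tuple_add h').
Qed.

Lemma borel_shift n (h : 'rV[R]_n) A : borel A -> borel [set x | A (x + h)].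
Proof.
apply: (@borel_preimage n n (+%R^~ h)) => i.
rewrite (_ : (fun _ => _) = fun t => row_of t 0 i + h 0 i).
  by apply: measurable_funD => //; exact: measurable_row_of.
by apply/funext => t; rewrite mxE.
Qed.

Lemma lebesgue_shift n (h : 'rV[R]_n) A : borel A ->
  lebesgue [set x | A (x + h)] = lebesgue A.
Proof.
move=> mA; rewrite !lebesgueE//; last exact: borel_shift.
rewrite -(lebesgue_tuple_shift (h 0) mA); congr (lebesgue_tuple R n _).
by apply/seteqP; split => t /=; congr A; apply/rowP => i;
  rewrite !mxE tnth_mktuple.
Qed.

Lemma measurable_mulmx d (T : measurableType d) m n (f : T -> 'rV[R]_m)
    (Q : 'M[R]_(m, n)) i :
  (forall k, measurable_fun setT (fun x => f x 0 k : measurableTypeR R)) ->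
  measurable_fun setT (fun x => (f x *m Q) 0 i : measurableTypeR R).
Proof.
move=> mf; rewrite (_ : (fun _ => _) = fun x => \sum_k f x 0 k * Q k i).
  apply: measurable_sum => k; apply: (measurable_funM (mf k)).
  exact: measurable_cst.
by apply/funext => x; rewrite mxE.
Qed.

Lemma measurable_addmx d (T : measurableType d) n (f g : T -> 'rV[R]_n) i :
  (forall k, measurable_fun setT (fun x => f x 0 k : measurableTypeR R)) ->
  (forall k, measurable_fun setT (fun x => g x 0 k : measurableTypeR R)) ->
  measurable_fun setT (fun x => (f x + g x) 0 i : measurableTypeR R).
Proof.
move=> mf mg; rewrite (_ : (fun _ => _) = fun x => f x 0 i + g x 0 i).
  exact: (measurable_funD (mf i) (mg i)).
by apply/funext => x; rewrite mxE.
Qed.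

Lemma measurable_submx d (T : measurableType d) n (f g : T -> 'rV[R]_n) i :
  (forall k, measurable_fun setT (fun x => f x 0 k : measurableTypeR R)) ->
  (forall k, measurable_fun setT (fun x => g x 0 k : measurableTypeR R)) ->
  measurable_fun setT (fun x => (f x - g x) 0 i : measurableTypeR R).
Proof.
move=> mf mg; rewrite (_ : (fun _ => _) = fun x => f x 0 i - g x 0 i).
  exact: (measurable_funB (mf i) (mg i)).
by apply/funext => x; rewrite !mxE.
Qed.

Lemma measurable_row_of_fst d (T : measurableType d) n i :
  measurable_fun setT
    (fun z : n.-tuple (measurableTypeR R) * T =>
       row_of z.1 0 i : measurableTypeR R).
Proof.
by apply: (measurableT_comp (@measurable_row_of n i)); exact: measurable_fst.
Qed.

Lemma measurable_row_of_snd d (T : measurableType d) n i :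
  measurable_fun setT
    (fun z : T * n.-tuple (measurableTypeR R) =>
       row_of z.2 0 i : measurableTypeR R).
Proof.
by apply: (measurableT_comp (@measurable_row_of n i)); exact: measurable_snd.
Qed.

Lemma borel_affine m n (Q : 'M[R]_(m, n)) (a : 'rV[R]_n) A : borel A ->
  borel [set x : 'rV[R]_m | A (a + x *m Q)].
Proof.
apply: (@borel_preimage m n (fun x => a + x *m Q)) => i.
apply: measurable_addmx => k; first exact: measurable_cst.
by apply: measurable_mulmx => j; exact: measurable_row_of.
Qed.

Lemma lebesgue_ge0 n (A : set 'rV[R]_n) : (0 <= lebesgue A)%E.
Proof. exact: mu_ext_ge0. Qed.

(** The measure of the pairs (x, y) such that x Q is in A and y - x Q is in B
    is vol(Q^-1 A) vol(B) when sliced at fixed x.  At fixed y, the translation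
    x |-> x + y Q^-1 turns the slice into that of the pairs such that x Q is in
    B and y + x Q is in A.  Thus a linear map multiplies all volumes by the
    same factor, which any convenient B determines. *)
Lemma lebesgue_unitmx n (Q : 'M[R]_n) (A B : set 'rV[R]_n) :
  Q \in unitmx -> borel A -> borel B -> (forall x, B x -> B (- x)) ->
  (lebesgue [set x | A (x *m Q)] * lebesgue B =
   lebesgue A * lebesgue [set x | B (x *m Q)])%E.
Proof.
move=> uQ mA mB symB; pose mu := lebesgue_tuple R n.
have mQ X : borel X -> borel [set x | X (x *m Q)].
  by move=> /(borel_affine Q 0); under eq_fun do rewrite add0r.
have mlin (z : n.-tuple (measurableTypeR R) * n.-tuple (measurableTypeR R) -> 'rV[R]_n) X :
  (forall k, measurable_fun setT (fun x => z x 0 k : measurableTypeR R)) ->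
  borel X -> measurable (z @^-1` X).
  exact: borel_comp.
(* At fixed second component, the slices of the next two sets differ by a translation. *)
pose E : set (n.-tuple (measurableTypeR R) * n.-tuple (measurableTypeR R)) :=
  [set z | A (row_of z.1 *m Q) /\ B (row_of z.2 - row_of z.1 *m Q)].
pose E' : set (n.-tuple (measurableTypeR R) * n.-tuple (measurableTypeR R)) :=
  [set z | B (row_of z.1 *m Q) /\ A (row_of z.2 + row_of z.1 *m Q)].
have mE : measurable E.
  apply: measurableI; apply: mlin => // k.
    by apply: measurable_mulmx => j; exact: measurable_row_of_fst.
  apply: measurable_submx => j; first exact: measurable_row_of_snd.
  by apply: measurable_mulmx => l; exact: measurable_row_of_fst.
have mE' : measurable E'.
  apply: measurableI; apply: mlin => // k.
    by apply: measurable_mulmx => j; exact: measurable_row_of_fst.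
  apply: measurable_addmx => j; first exact: measurable_row_of_snd.
  by apply: measurable_mulmx => l; exact: measurable_row_of_fst.
have sect (C D : set 'rV[R]_n) (s : 'rV[R]_n -> 'rV[R]_n)
    (F : set (n.-tuple (measurableTypeR R) * n.-tuple (measurableTypeR R))) :
  borel C -> borel D -> measurable F ->
  F = [set z | C (row_of z.1 *m Q) /\ D (row_of z.2 + s (row_of z.1))] ->
  (mu \x mu)%E F = (lebesgue D * lebesgue [set x | C (x *m Q)])%E.
  move=> mC mD mF FE; rewrite (lebesgueE (mQ _ mC)).
  apply: product_measure_sections => //; first exact: mQ.
    exact: lebesgue_ge0.
  move=> t; rewrite indicE.
  have [|] := boolP (t \in _); rewrite ?inE/= => tC.
    rewrite mule1 -(lebesgue_shift (s (row_of t)) mD) lebesgueE; last first.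
      exact: borel_shift.
    congr (mu _); apply/seteqP; split => r; rewrite /xsection FE /= inE/=.
      by case.
    by split.
  rewrite mule0 (_ : xsection F t = set0) ?measure0//.
  by rewrite -subset0 => r; rewrite /xsection FE /= inE/= => -[/=]; rewrite notin_setE in tC.
rewrite muleC -(sect A B (fun x => - (x *m Q)) E)//.
rewrite -(sect B A (fun x => x *m Q) E')//.
rewrite !product_measure_ysections//; apply: eq_integral => s _.
rewrite -(@lebesgue_tuple_shift n ((row_of s *m invmx Q) 0)); last first.
  by apply: measurable_ysection.
congr (mu _); apply/seteqP; rewrite /ysection; split => t; rewrite /= !inE /E /E' /=.
all: have -> : row_of (tuple_add ((row_of s *m invmx Q) 0) t) =
    row_of t + row_of s *m invmx Q
  by apply/rowP => i; rewrite !mxE tnth_mktuple; congr (_ + _); rewrite mxE.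
all: rewrite mulmxDl mulmxKV// opprD addrCA subrr addr0 => -[h1 h2].
  by rewrite addrC; split => //; rewrite -[_ *m _]opprK; exact: symB.
by rewrite addrC; split => //; exact: symB.
Qed.

End tuples.

(** * Euclidean structure *)

Section dot.
Context (R : realType) (n : nat).
Implicit Types (x y z : 'rV[R]_n) (k : R).

Lemma dotC x y : dot x y = dot y x.
Proof. by apply: eq_bigr => i _; rewrite mulrC. Qed.

Lemma dotDl x y z : dot (x + y) z = dot x z + dot y z.
Proof. by rewrite /dot -big_split /=; apply: eq_bigr => i _; rewrite mxE mulrDl. Qed.

Lemma dotZl k x y : dot (k *: x) y = k * dot x y.
Proof. by rewrite /dot big_distrr /=; apply: eq_bigr => i _; rewrite mxE mulrA. Qed.

Lemma dotNl x y : dot (- x) y = - dot x y.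
Proof. by rewrite -scaleN1r dotZl mulN1r. Qed.

Lemma dotBl x y z : dot (x - y) z = dot x z - dot y z.
Proof. by rewrite dotDl dotNl. Qed.

Lemma dotDr x y z : dot x (y + z) = dot x y + dot x z.
Proof. by rewrite dotC dotDl !(dotC x). Qed.

Lemma dotZr k x y : dot x (k *: y) = k * dot x y.
Proof. by rewrite dotC dotZl dotC. Qed.

Lemma dotNr x y : dot x (- y) = - dot x y.
Proof. by rewrite dotC dotNl dotC. Qed.

Lemma dotBr x y z : dot x (y - z) = dot x y - dot x z.
Proof. by rewrite dotDr dotNr. Qed.

Lemma dot0l x : dot 0 x = 0.
Proof. by rewrite -(scale0r 0) dotZl mul0r. Qed.

Lemma dot_ge0 x : 0 <= dot x x.
Proof. by apply: sumr_ge0 => i _; rewrite -expr2 sqr_ge0. Qed.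

Lemma dot_eq0 x : (dot x x == 0) = (x == 0).
Proof.
apply/eqP/eqP => [x0|->]; last exact: dot0l.
apply/rowP => i; rewrite mxE; apply/eqP.
have /psumr_eq0P/(_ x0 i isT)/eqP := fun i (_ : true) => sqr_ge0 (x 0 i).
by rewrite sqrf_eq0.
Qed.

Lemma dot_gt0 x : x != 0 -> 0 < dot x x.
Proof. by move=> x0; rewrite lt_neqAle dot_ge0 eq_sym dot_eq0 x0. Qed.

Lemma mulmx_tr x y : x *m y^T = (dot x y)%:M.
Proof.
apply/matrixP => i j; rewrite !ord1 !mxE eqxx mulr1n.
by apply: eq_bigr => k _; rewrite mxE.
Qed.

Lemma enormE x : enorm x ^+ 2 = dot x x.
Proof. by rewrite sqr_sqrtr// dot_ge0. Qed.

Lemma enorm_ge0 x : 0 <= enorm x.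
Proof. exact: sqrtr_ge0. Qed.

Lemma enorm_gt0 x : x != 0 -> 0 < enorm x.
Proof. by move=> x0; rewrite sqrtr_gt0 dot_gt0. Qed.

Lemma enormZ k x : enorm (k *: x) = `|k| * enorm x.
Proof.
by rewrite /enorm dotZl dotZr mulrA -expr2 sqrtrM ?sqr_ge0// sqrtr_sqr.
Qed.

Lemma coord_le_enorm x i : `|x 0 i| <= enorm x.
Proof.
rewrite -(ler_pXn2r (n := 2))// ?nnegrE ?enorm_ge0// enormE.
rewrite real_normK ?num_real// /dot (bigD1 i)//= -expr2 lerDl.
by apply: sumr_ge0 => j _; rewrite -expr2 sqr_ge0.
Qed.

Lemma unit_dot_le x y (M : R) : dot x x = 1 -> (forall i, `|y 0 i| <= M) ->
  `|dot x y| <= n%:R * M.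
Proof.
move=> x1 yM; rewrite (le_trans (ler_norm_sum _ _ _))//.
rewrite -[n in n%:R]card_ord mulr_natl -sumr_const; apply: ler_sum => i _.
rewrite normrM -[leRHS]mul1r ler_pM//.
by rewrite (le_trans (coord_le_enorm x i))// /enorm x1 sqrtr1.
Qed.

Lemma dot_normalize x : x != 0 ->
  dot ((enorm x)^-1 *: x) ((enorm x)^-1 *: x) = 1.
Proof.
move=> x0; rewrite dotZl dotZr -enormE mulrA -expr2 -exprMn mulVf ?expr1n//.
by rewrite gt_eqF// enorm_gt0.
Qed.

End dot.

(** * Volumes of balls, isometries and dilations *)

Section lebesgue_basic.
Context (R : realType) (n : nat).
Implicit Types (A B : set 'rV[R]_n).

Lemma le_lebesgue A B : A `<=` B -> (lebesgue A <= lebesgue B)%E.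
Proof. by move=> AB; apply: le_mu_ext => t; exact: AB. Qed.

Lemma lebesgue0 : lebesgue (set0 : set 'rV[R]_n) = 0%E.
Proof. by rewrite /lebesgue mu_ext0. Qed.

Lemma lebesgue_subadditive A B : (lebesgue (A `|` B) <= lebesgue A + lebesgue B)%E.
Proof.
pose pre := fun X : set 'rV[R]_n => [set t : n.-tuple (measurableTypeR R) | X (\row_i tnth t i)].
exact: (@outer_measureU2 _ _ (mu_ext (lebesgue_tuple R n)) (pre A) (pre B)).
Qed.

Lemma lebesgue_bigcup (I : eqType) (r : seq I) (F : I -> set 'rV[R]_n) A :
  (forall x, A x -> exists2 i, i \in r & F i x) ->
  (lebesgue A <= \sum_(i <- r) lebesgue (F i))%E.
Proof.
elim: r A => [|i r IH] A AF.
  by rewrite big_nil -lebesgue0; apply: le_lebesgue => x /AF[].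
rewrite big_cons; have AU : A `<=` F i `|` [set x | exists2 j, j \in r & F j x].
  move=> x /AF[j]; rewrite inE => /predU1P[->|jr] Fx; first by left.
  by right; exists j.
apply: (le_trans (le_lebesgue AU)); apply: (le_trans (lebesgue_subadditive _ _)).
by apply: leeD => //; exact: IH.
Qed.

End lebesgue_basic.

Section lebesgue_balls.
Context (R : realType).

Lemma lebesgue_tuple_ball n (x : 'rV[R]_n) (r : R) : 0 < r ->
  lebesgue_tuple R n [set t | forall i, `|x 0 i - tnth t i| < r] =
  ((2 * r) ^+ n)%:E.
Proof.
move=> r0; elim: n x => [|n IH] x.
  rewrite /= diracE (_ : (_ \in _) = true) ?expr0//.
  by apply/mem_set; case.
pose x' : 'rV[R]_n := \row_i x 0 (lift ord0 i).
pose I : set (measurableTypeR R) := `]x 0 ord0 - r, x 0 ord0 + r[%classic.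
pose B : set (n.-tuple (measurableTypeR R)) :=
  [set t | forall i, `|x' 0 i - tnth t i| < r].
have mB : measurable B.
  rewrite (_ : B = (@row_of R n) @^-1` ball x' r); first exact: borel_ball.
  apply/seteqP; split=> t /=.
    by move=> Bt; apply/(ball_rowP _ _ r0) => i; rewrite [X in _ - X]mxE; exact: Bt.
  by move/(ball_rowP _ _ r0) => Bt i; have := Bt i; rewrite [X in _ - X]mxE.
rewrite /= /cons_product /pushforward /=.
rewrite (_ : _ @^-1` _ = I `*` B).
  rewrite product_measure1E//; last exact: measurable_itv.
  rewrite IH exprS EFinM; congr (_ * _)%E.
  rewrite -[LHS]/(lebesgue_measure I) lebesgue_measure_itv /= lte_fin ifT; last by lra.
  by rewrite -EFinD; congr EFin; ring.
apply/seteqP; split=> -[y t] /=; rewrite /tuple_cons /= => h.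
  split; first by have := h ord0; rewrite tnth0 /I /= in_itv/= ltr_norml; lra.
  by move=> i; rewrite mxE; have := h (lift ord0 i); rewrite tnthS.
move=> i; case: (unliftP ord0 i) => [j ->|->].
  by rewrite tnthS; have := h.2 j; rewrite mxE.
by rewrite tnth0; have := h.1; rewrite /I /= in_itv/= ltr_norml; lra.
Qed.

Lemma lebesgue_ball n (x : 'rV[R]_n) (r : R) : 0 < r ->
  lebesgue (ball x r) = ((2 * r) ^+ n)%:E.
Proof.
move=> r0; rewrite lebesgueE; last exact: borel_ball.
rewrite -(lebesgue_tuple_ball x r0); congr (lebesgue_tuple R n _).
apply/seteqP; split=> t /=.
  by move/(ball_rowP _ _ r0) => Bt i; have := Bt i; rewrite [X in _ - X]mxE.
by move=> Bt; apply/(ball_rowP _ _ r0) => i; rewrite [X in _ - X]mxE; exact: Bt.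
Qed.

Lemma lebesgue_bounded_lty n (A : set 'rV[R]_n) (M : R) :
  (forall x, A x -> forall i, `|x 0 i| <= M) -> (lebesgue A < +oo)%E.
Proof.
move=> AM; pose r := `|M| + 1; have r0 : 0 < r by rewrite ltr_wpDl.
have Ar : A `<=` ball 0 r.
  move=> x Ax; apply/(ball_rowP _ _ r0) => i; rewrite mxE sub0r normrN.
  by rewrite (le_lt_trans (AM x Ax i))// (le_lt_trans (ler_norm M))// ltrDl.
by rewrite (le_lt_trans (le_lebesgue Ar))// lebesgue_ball// ltry.
Qed.

Lemma lebesgue_gt0 n (A : set 'rV[R]_n) : open A -> A !=set0 ->
  (0 < lebesgue A)%E.
Proof.
move=> oA [x Ax]; have /nbhs_ballP[e/= e0 xe] : nbhs x A by exact: oA.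
rewrite (lt_le_trans _ (le_lebesgue xe))// lebesgue_ball//.
by rewrite lte_fin exprn_gt0// mulr_gt0.
Qed.

Lemma dotE n (x y : 'rV[R]_n) : dot x y = (x *m y^T) 0 0.
Proof. by rewrite mulmx_tr mxE eqxx mulr1n. Qed.

Lemma dot_mulmx m n (Q : 'M[R]_(m, n)) (x y : 'rV[R]_m) : Q *m Q^T = 1%:M ->
  dot (x *m Q) (y *m Q) = dot x y.
Proof. by move=> QQ; rewrite !dotE trmx_mul mulmxA -(mulmxA x) QQ mulmx1. Qed.

Lemma continuous_dot (T : topologicalType) n (f g : T -> 'rV[R]_n) :
  (forall i, continuous (fun t => f t 0 i)) ->
  (forall i, continuous (fun t => g t 0 i)) ->
  continuous (fun t => dot (f t) (g t)).
Proof.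
move=> cf cg; rewrite (_ : (fun _ => _) = \sum_i (fun t => f t 0 i * g t 0 i)).
  elim/big_ind : _ => [|h k ch ck|i _] t; first exact: cvg_cst.
    exact: continuousD (ch t) (ck t).
  exact: continuousM (cf i t) (cg i t).
by apply/funext => t; rewrite fct_sumE.
Qed.

Lemma dot_continuous n (v : 'rV[R]_n) : continuous (dot v).
Proof.
apply: continuous_dot => i; last exact: coord_continuous.
exact: cst_continuous.
Qed.

Lemma open_comp_continuous (T U : topologicalType) (f : T -> U) D :
  continuous f -> open D -> open (f @^-1` D).
Proof. by move=> cf; apply: open_comp => x _; exact: cf. Qed.

(** The Euclidean unit ball is invariant under Q, and its volume is neither 0
    nor infinite, so the common factor of [lebesgue_unitmx] is 1. *)
Lemma lebesgue_orthogonal n (Q : 'M[R]_n) (A : set 'rV[R]_n) :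
  Q *m Q^T = 1%:M -> borel A -> lebesgue [set x | A (x *m Q)] = lebesgue A.
Proof.
move=> QQ mA; have [uQ _] := mulmx1_unit QQ.
pose B := [set x : 'rV[R]_n | dot x x < 1].
have oB : open B.
  apply: (@open_comp_continuous _ _ (fun x => dot x x) [set k | k < 1]).
    by apply: continuous_dot => i; exact: coord_continuous.
  exact: open_lt.
have B0 : B !=set0 by exists 0; rewrite /B /= dot0l.
have B1 : (lebesgue B < +oo)%E.
  apply: (@lebesgue_bounded_lty _ _ 1) => x /ltW Bx i.
  rewrite (le_trans (coord_le_enorm x i))// /enorm -[leRHS]sqrtr1.
  by rewrite ler_wsqrtr.
have symB x : B x -> B (- x) by rewrite /B /= dotNl dotNr opprK.
have := lebesgue_unitmx uQ mA (borel_open oB) symB.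
rewrite (_ : [set x | B (x *m Q)] = B); last first.
  by apply/seteqP; split=> x; rewrite /B /= dot_mulmx.
have := lebesgue_gt0 oB B0; move: B1.
case: (lebesgue B) (lebesgue_ge0 B) => // r _ _ r0.
move=> /(congr1 (fun z => z * (r^-1)%:E)%E).
by rewrite -!muleA -!EFinM divff ?gt_eqF// !mule1.
Qed.

(** The factor is read off on the cube [ball 0 1], which becomes a cube of half
    side 1 / r. *)
Lemma lebesgue_dilation n (A : set 'rV[R]_n) (a : 'rV[R]_n) (r : R) : 0 < r ->
  borel A -> lebesgue [set x | A (a + r *: x)] = ((r^-1 ^+ n)%:E * lebesgue A)%E.
Proof.
move=> r0 mA; have r0' : r != 0 by rewrite gt_eqF.
pose A' := [set x | A (x + a)].
have mA' : borel A' := borel_shift a mA.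
have uQ : (r%:M : 'M[R]_n) \in unitmx by rewrite unitmxE det_scalar unitrX// unitfE.
have symB x : (ball 0 1 : set 'rV[R]_n) x -> (ball 0 1 : set 'rV[R]_n) (- x).
  move=> /(ball_rowP _ _ ltr01) h; apply/(ball_rowP _ _ ltr01) => i.
  by have := h i; rewrite !mxE !sub0r !normrN.
have := lebesgue_unitmx uQ mA' (@borel_ball R n 0 1) symB.
rewrite (_ : [set x | ball 0 1 (x *m r%:M)] = ball 0 r^-1); last first.
  have rV0 : 0 < r^-1 by rewrite invr_gt0.
  apply/seteqP; split=> x.
    move=> /(ball_rowP _ _ ltr01) h; apply/(ball_rowP _ _ rV0) => i.
    have := h i; rewrite mul_mx_scalar !mxE !sub0r !normrN normrM gtr0_norm//.
    by rewrite -ltr_pdivlMl// mulr1.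
  move=> /(ball_rowP _ _ rV0) h; apply/(ball_rowP _ _ ltr01) => i.
  have := h i; rewrite mul_mx_scalar !mxE !sub0r !normrN normrM gtr0_norm//.
  by rewrite -ltr_pdivlMl// mulr1.
rewrite !lebesgue_ball ?invr_gt0// lebesgue_shift//.
rewrite (_ : [set x | A' (x *m r%:M)] = [set x | A (a + r *: x)]); last first.
  by apply/seteqP; split=> x; rewrite /A' /= mul_mx_scalar addrC.
move=> /(congr1 (fun z => z * ((2 ^+ n)^-1)%:E)%E).
rewrite -!muleA -!EFinM mulr1 divff ?expf_neq0// mule1 => ->.
by rewrite exprMn mulrAC divff ?expf_neq0// mul1r muleC.
Qed.

(** * Orthonormal frames *)

(** A unit normal with an orthonormal basis of its orthogonal: the rows of V
    parametrize the hyperplanes of normal e isometrically. *)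
Definition frame n (e : 'rV[R]_n.+1) (V : 'M[R]_(n, n.+1)) :=
  [/\ V *m V^T = 1%:M, V *m e^T = 0 & dot e e = 1].

Lemma frame_orthogonal n (e : 'rV[R]_n.+1) V : frame e V ->
  (col_mx e V : 'M[R]_(1 + n)) *m (col_mx e V)^T = 1%:M.
Proof.
move=> [VV Ve ee]; rewrite tr_col_mx mul_col_row mulmx_tr ee VV Ve.
rewrite (_ : e *m V^T = 0) ?scalar_mx_block//.
by apply: trmx_inj; rewrite trmx_mul trmxK Ve trmx0.
Qed.

Lemma frame_decomp n (e : 'rV[R]_n.+1) V (x : 'rV[R]_n.+1) : frame e V ->
  x = dot x e *: e + (x *m V^T) *m V.
Proof.
move=> fr; have /mulmx1C := frame_orthogonal fr.
rewrite tr_col_mx mul_row_col => QQ.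
by rewrite -[LHS]mulmx1 -QQ mulmxDr !mulmxA mulmx_tr mul_scalar_mx.
Qed.

(** A reflection maps the first basis vector e0 to e; the images of the other
    basis vectors are the rows of V. *)
Lemma frame_of_normal n (e : 'rV[R]_n.+1) : dot e e = 1 -> exists V, frame e V.
Proof.
move=> ee; pose e0 : 'rV[R]_n.+1 := delta_mx 0 0.
have e0e0 : dot e0 e0 = 1.
  rewrite /dot (bigD1 ord0)//= big1 ?addr0 ?mxE ?eqxx ?mulr1//.
  by move=> i i0; rewrite !mxE (negPf i0) andbF mul0r.
have [Q [QQ Qe]] : exists Q : 'M[R]_n.+1, Q *m Q^T = 1%:M /\ e0 *m Q = e.
  have [<-|e0e] := eqVneq e0 e; first by exists 1%:M; rewrite trmx1 !mulmx1.
  pose w := e0 - e; have w0 : dot w w != 0 by rewrite dot_eq0 subr_eq0.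
  have ww : dot w w = 2 * (1 - dot e0 e).
    by rewrite /w !(dotBl, dotBr) e0e0 ee (dotC e); ring.
  have [c cE] : exists c, c * dot w w = 2.
    by exists (2 / dot w w); rewrite mulfVK.
  (* The reflection in the hyperplane orthogonal to e0 - e. *)
  exists (1%:M - c *: (w^T *m w)); split; last first.
    rewrite mulmxBr mulmx1 -scalemxAr mulmxA mulmx_tr mul_scalar_mx scalerA.
    rewrite (_ : c * _ = 1) ?scale1r; last first.
      have -> : dot e0 w = 1 - dot e0 e by rewrite dotBr e0e0.
      by move: cE; rewrite ww; lra.
    by rewrite /w opprB addrC subrK.
  set P := w^T *m w.
  have PP : P *m P = dot w w *: P.
    by rewrite mulmxA -(mulmxA w^T) mulmx_tr mul_mx_scalar -scalemxAl.
  have -> : (1%:M - c *: P)^T = 1%:M - c *: P.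
    have PT : P^T = P by rewrite trmx_mul trmxK.
    have trE (B : 'M[R]_n.+1) : (1%:M - c *: B)^T = 1%:M - c *: B^T.
      by apply/matrixP => i j; rewrite !mxE eq_sym.
    by rewrite trE PT.
  rewrite mulmxBl mul1mx mulmxBr mulmx1 -scalemxAl -scalemxAr PP !scalerA.
  rewrite opprB addrA -addrA -[RHS]addr0 -!addrA; congr (_ + _).
  rewrite -!scaleNr -!scalerDl (_ : _ + _ = 0) ?scale0r//.
  by rewrite -mulrA cE; ring.
exists (dsubmx (Q : 'M[R]_(1 + n, n.+1))).
have eQ : usubmx (Q : 'M[R]_(1 + n, n.+1)) = e.
  rewrite -Qe; apply/rowP => j; rewrite !mxE (bigD1 ord0)//= big1.
    rewrite addr0 mxE !eqxx mul1r; congr (Q _ _); exact: val_inj.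
  by move=> i i0; rewrite mxE (negPf i0) andbF mul0r.
have QE : (Q : 'M[R]_(1 + n, n.+1)) = col_mx e (dsubmx (Q : 'M[R]_(1 + n, n.+1))).
  by rewrite -eQ vsubmxK.
have : (Q : 'M[R]_(1 + n, n.+1)) *m (Q : 'M[R]_(1 + n, n.+1))^T = 1%:M := QQ.
move: (dsubmx _) QE => V ->; rewrite tr_col_mx mul_col_row (@scalar_mx_block _ 1 n).
by move=> /eq_block_mx[_ _ h1 h2]; split.
Qed.

(** V has more columns than rows, so its transpose has a nontrivial kernel. *)
Lemma frame_of_rows n (V : 'M[R]_(n, n.+1)) : V *m V^T = 1%:M ->
  exists e, frame e V.
Proof.
move=> VV; pose x := nz_row (kermx V^T).
have x0 : x != 0.
  rewrite nz_row_eq0 -mxrank_eq0 mxrank_ker -lt0n subn_gt0.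
  by rewrite (leq_ltn_trans (rank_leq_col _)).
have xV : x *m V^T = 0 by apply/sub_kermxP; exact: nz_row_sub.
exists ((enorm x)^-1 *: x); split => //.
  by apply: trmx_inj; rewrite trmx_mul trmxK -scalemxAl xV scaler0 trmx0.
exact: dot_normalize.
Qed.

End lebesgue_balls.

(** * Slicing along a frame, swept sets *)

Section sweeps.
Context (R : realType).

Lemma row_of_cons n (tau : measurableTypeR R) (t : n.-tuple (measurableTypeR R))
    (e : 'rV[R]_n.+1) (V : 'M[R]_(n, n.+1)) :
  row_of (tuple_cons (tau, t)) *m (col_mx e V : 'M[R]_(1 + n, n.+1)) =
  tau *: e + row_of t *m V.
Proof.
rewrite -mul_scalar_mx -mul_row_col; congr (_ *m _); apply/rowP => i.
rewrite mxE; case: (unliftP ord0 i) => [j ->|->].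
  rewrite tnthS (_ : lift ord0 j = rshift 1 (j : 'I_n)); last exact: val_inj.
  by apply/esym; apply: etrans (@row_mxEr _ 1 1 n _ _ _ _) _; rewrite mxE.
rewrite tnth0 (_ : (ord0 : 'I_n.+1) = lshift n (ord0 : 'I_1)); last exact: val_inj.
by apply/esym; apply: etrans (@row_mxEl _ 1 1 n _ _ _ _) _; rewrite mxE mulr1n.
Qed.

Lemma frame_dot n (e : 'rV[R]_n.+1) V (s : 'rV_n) : frame e V ->
  dot (s *m V) e = 0.
Proof. by move=> [_ Ve _]; rewrite dotE -mulmxA Ve mulmx0 mxE. Qed.

Section frames.
Context (n : nat) (e : 'rV[R]_n.+1) (V : 'M[R]_(n, n.+1)) (fr : frame e V).
Implicit Types (a : 'rV[R]_n.+1) (A : set 'rV[R]_n.+1).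

(** In the orthonormal coordinates (e, V) around a, the volume is the product of
    the length along e by the volume in R^n. *)
Lemma frame_product a A : borel A ->
  exists E : set (measurableTypeR R * n.-tuple (measurableTypeR R)),
    [/\ measurable E,
        lebesgue A = (@lebesgue_measure R \x lebesgue_tuple R n)%E E &
        forall tau, lebesgue_tuple R n (xsection E tau) =
          lebesgue [set s | A (a + tau *: e + s *m V)]].
Proof.
move=> mA; pose Q : 'M[R]_(n.+1) := (col_mx e V : 'M[R]_(1 + n, n.+1)).
have mA1 := borel_shift a mA.
have mA2 := borel_affine Q 0 mA1.
exists (@tuple_cons _ n @^-1` (@row_of R n.+1 @^-1`
  [set y : 'rV_n.+1 | A (0 + y *m Q + a)])); split.
- by rewrite -[X in measurable X]setTI; exact: measurable_tuple_cons.
- rewrite -(lebesgue_shift a mA) -(lebesgue_orthogonal (frame_orthogonal fr) mA1).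
  rewrite lebesgueE; last by move: mA2; under eq_fun do rewrite add0r.
  by under [in RHS]eq_fun do rewrite add0r.
move=> tau; rewrite lebesgueE; last exact: borel_affine.
have rowE t : 0 + row_of (tuple_cons (tau, t)) *m Q + a =
    a + tau *: e + row_of t *m V by rewrite row_of_cons add0r addrC addrA.
congr (lebesgue_tuple R n _); apply/seteqP; rewrite /xsection; split => t /=.
  by rewrite inE /= rowE.
by rewrite inE /= rowE.
Qed.

Lemma lebesgue_frame_le a A (J : set (measurableTypeR R)) (c : \bar R) :
  borel A -> measurable J -> (0 <= c)%E ->
  (forall tau, lebesgue [set s | A (a + tau *: e + s *m V)%R] <=
    c * (\1_J tau)%:E)%E ->
  (lebesgue A <= c * lebesgue_measure J)%E.
Proof.
move=> mA mJ c0 Ac; have [E [mE -> EA]] := frame_product a mA.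
by apply: product_measure_le_sections => // tau; rewrite EA.
Qed.

Lemma lebesgue_frame_ge a A (J : set (measurableTypeR R)) (c : \bar R) :
  borel A -> measurable J -> (0 <= c)%E ->
  (forall tau, c * (\1_J tau)%:E <=
    lebesgue [set s | A (a + tau *: e + s *m V)%R])%E ->
  (c * lebesgue_measure J <= lebesgue A)%E.
Proof.
move=> mA mJ c0 Ac; have [E [mE -> EA]] := frame_product a mA.
by apply: product_measure_ge_sections => // tau; rewrite EA.
Qed.

(** The slices are empty except over one point, which has length 0, so that
    even the bound +oo on its slice gives a null volume. *)
Lemma lebesgue_flat a A : borel A -> (forall x, A x -> dot x e = dot a e) ->
  lebesgue A = 0%E.
Proof.
move=> mA Ae; apply/eqP; rewrite eq_le lebesgue_ge0 andbT.
have := @lebesgue_frame_le a A [set 0] +oo%E mA.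
rewrite lebesgue_measure_set1 mule0; apply => //.
move=> tau; rewrite indicE; have [->|t0] := eqVneq tau 0.
  by rewrite mem_set// mule1 leey.
rewrite (_ : [set _ | _] = set0) ?lebesgue0 ?mule_ge0//.
rewrite -subset0 => s /= /Ae; rewrite !dotDl dotZl.
have [_ _ ee] := fr; rewrite ee (frame_dot _ fr) => h.
by move: t0; rewrite (_ : tau = 0) ?eqxx//; lra.
Qed.

End frames.

Lemma closed_hyperplane n (v : 'rV[R]_n) b : closed (hyperplane v b).
Proof.
rewrite (_ : hyperplane v b = dot v @^-1` [set x | x = b])//.
by apply: preimage_closed; [move=> x _; exact: dot_continuous|exact: closed_eq].
Qed.

Lemma lebesgue_hyperplane n (v : 'rV[R]_n.+1) b : v != 0 ->
  lebesgue (hyperplane v b) = 0%E.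
Proof.
move=> v0; pose e := (enorm v)^-1 *: v.
have ee : dot e e = 1 by exact: dot_normalize.
have [V fr] := frame_of_normal ee.
apply: (lebesgue_flat fr (a := (b / enorm v) *: e)).
  by apply: borel_closed; exact: closed_hyperplane.
by move=> x /= xb; rewrite dotZl ee mulr1 dotZr dotC xb mulrC.
Qed.

(** Compactness of [0, 1]: when the whole segment avoids F, so do the segments
    with nearby parameters. *)
Lemma closed_segment_hits (T : topologicalType) n (f g : T -> 'rV[R]_n)
    (F : set 'rV[R]_n) : continuous f -> continuous g -> closed F ->
  closed [set y | exists t : R, (0 <= t <= 1) /\ F (f y + t *: g y)].
Proof.
move=> cf cg cF; rewrite -openC openE => y /= Fy; rewrite /interior.
have := @segment_compact R 0 1; move/compact_near_coveringP => cov.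
have : \forall y' \near y, `[0, 1]%classic `<=`
    [set t | ~ F (f y' + t *: g y')].
  apply: cov => t; rewrite /= in_itv/= => t01.
  have Ft : ~ F (f y + t *: g y) by move=> Fyt; apply: Fy; exists t.
  have cont : {for (t, y), continuous (fun z : R * T => f z.2 + z.1 *: g z.2)}.
    apply: (@continuousD _ _ _ (fun z : R * T => f z.2)).
      by apply: (@continuous_comp _ _ _ snd f); [exact: cvg_snd|exact: cf].
    apply: continuousZ; first exact: cvg_fst.
    by apply: (@continuous_comp _ _ _ snd g); [exact: cvg_snd|exact: cg].
  have nF : nbhs (f y + t *: g y) (~` F).
    by apply: open_nbhs_nbhs; split => //; exact: closed_openC.
  exact: (cont _ nF).
by apply: filterS => y' h [t [t01]]; apply: h; rewrite /= in_itv.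
Qed.

(** The set is an oblique prism along h with base F.  Its slices orthogonal to e
    are contained in translates of F, and there are slices only over an
    interval of length |h.e|. *)
Lemma lebesgue_sweep n (e a h : 'rV[R]_n.+1) V (F : set 'rV[R]_n.+1) :
  frame e V -> closed F -> F `<=` [set a + s *m V | s in [set: 'rV_n]] ->
  (lebesgue [set x | exists t : R, (0 <= t <= 1)%R /\ F (x + t *: h)%R] <=
   `|dot h e|%:E * lebesgue [set s | F (a + s *m V)%R])%E.
Proof.
move=> fr cF Fa; have [VV Ve ee] := fr; set T := [set x | _].
have mT : borel T.
  apply: borel_closed; apply: (@closed_segment_hits 'rV[R]_n.+1 n.+1 id (fun=> h)) => //.
    by move=> x; exact: cvg_id.
  exact: cst_continuous.
have Fe x : F x -> dot x e = dot a e.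
  by move=> /Fa[s _ <-]; rewrite dotDl (frame_dot _ fr) addr0.
set eta := dot h e.
have [eta0|eta0] := eqVneq eta 0.
  rewrite eta0 normr0 mul0e (lebesgue_flat fr (a := a))// => x [t [_ /Fe]].
  by rewrite dotDl dotZl -/eta eta0 mulr0 addr0.
(* The abscissas along e, counted from a, of the points x with x + t h in F for
   some t in [0, 1]. *)
pose J : set (measurableTypeR R) := `[Num.min 0 (- eta), Num.max 0 (- eta)]%classic.
have J1 : lebesgue_measure J = `|eta|%:E.
  rewrite /J lebesgue_measure_itv /= lte_fin.
  have [e0|e0] := ltP eta 0.
    by rewrite min_l ?max_r; [|lra|lra]; rewrite ifT; [|lra]; rewrite -EFinD subr0 ltr0_norm.
  have {}e0 : 0 < eta by rewrite lt_neqAle eq_sym eta0.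
  by rewrite min_r ?max_l; [|lra|lra]; rewrite ifT; [|lra]; rewrite -EFinD opprK add0r gtr0_norm.
rewrite muleC -J1; apply: (lebesgue_frame_le fr (a := a)) => //.
- exact: measurable_itv.
- exact: lebesgue_ge0.
move=> tau; set S := [set s | _].
(* A point of the slice at abscissa tau is hit at time t = - tau / eta. *)
have key s : S s -> tau \in J /\ F (a + (s - (tau / eta) *: (h *m V^T)) *m V).
  move=> [t [t01 Ft]]; have := Fe _ Ft.
  rewrite !dotDl !dotZl ee (frame_dot _ fr) -/eta => te.
  have tE : tau = - (t * eta) by lra.
  split.
    rewrite inE /J /= in_itv/=; apply/andP.
    have [e0|e0] := ltP eta 0.
      by rewrite min_l ?max_r; [|lra|lra]; split; nra.
    by rewrite min_r ?max_l; [|lra|lra]; split; nra.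
  move: Ft; rewrite {1}(frame_decomp h fr) -/eta tE.
  rewrite mulNr mulfK// mulmxBl -scalemxAl; congr F.
  move: (h *m _ *m V) (s *m V) => u w; apply/rowP => i; rewrite !mxE; ring.
have [tJ|tJ] := boolP (tau \in J); rewrite indicE.
  rewrite tJ mule1 -[leRHS](lebesgue_shift (- ((tau / eta) *: (h *m V^T)))).
    by apply: le_lebesgue => s /key[].
  by apply: borel_affine; exact: borel_closed.
rewrite (negPf tJ) mule0 (_ : S = set0) ?lebesgue0//.
by rewrite -subset0 => s /key[]; rewrite (negPf tJ).
Qed.

End sweeps.

(** * Convex sets *)

Section convexity.
Context (R : realType) (n : nat).
Implicit Types (A K : set 'rV[R]_n) (x y z : 'rV[R]_n).

Lemma convE (x y : convex_lmodType 'rV[R]_n) (t : {i01 R}) :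
  conv t x y = t%:num *: (x : 'rV[R]_n) + (1 - t%:num) *: (y : 'rV[R]_n).
Proof. by []. Qed.

Lemma convex_setP A x y (t : R) : @convex_set R 'rV[R]_n A -> A x -> A y ->
  0 <= t -> t <= 1 -> A (t *: x + (1 - t) *: y).
Proof.
move=> cA Ax Ay t0 t1; have := cA x y (Itv01 t0 t1).
by rewrite !inE; apply.
Qed.

Lemma convex_ball x (r : R) : @convex_set R 'rV[R]_n (ball x r).
Proof.
have [r0|r0] := ltP 0 r; last first.
  by move=> y z t; rewrite inE => -[/lt_le_trans/(_ r0)]; rewrite ltxx.
move=> y z t; rewrite !inE => /(ball_rowP _ _ r0) xy /(ball_rowP _ _ r0) xz.
apply/(ball_rowP _ _ r0) => i; have := xy i; have := xz i.
have t0 : 0 <= t%:num by []; have t1 : t%:num <= 1 by [].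
rewrite convE !mxE /= !ltr_norml => /andP[a1 a2] /andP[b1 b2].
move: (t%:num) t0 t1 => k k0 k1; apply/andP.
set u := x 0 i in a1 a2 b1 b2 *; set v := y 0 i in a1 a2 b1 b2 *.
set w := z 0 i in a1 a2 b1 b2 *.
have [k2|k2] := eqVneq k 0; first by rewrite k2; split; lra.
have {k2} k0' : 0 < k by rewrite lt_neqAle eq_sym k2.
split; nra.
Qed.

Lemma convex_halfspace (v : 'rV[R]_n) (b : R) :
  @convex_set R 'rV[R]_n [set x | dot v x < b].
Proof.
move=> x y t; rewrite !inE /= => xb yb.
rewrite convE dotDr !dotZr.
have t0 : 0 <= t%:num by []; have t1 : t%:num <= 1 by [].
move: (t%:num) t0 t1 => k k0 k1.
have [k2|k2] := eqVneq k 0; first by rewrite k2; lra.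
have {k2} k0' : 0 < k by rewrite lt_neqAle eq_sym k2.
nra.
Qed.

Lemma open_ball_row x (r : R) : open (ball x r).
Proof.
have [r0|r0] := ltP 0 r; first exact: ball_open.
rewrite (_ : ball x r = set0); first exact: open0.
by rewrite -subset0 => y [/lt_le_trans/(_ r0)]; rewrite ltxx.
Qed.

Lemma open_halfspace (v : 'rV[R]_n) (b : R) : open [set x | dot v x < b].
Proof.
apply: (@open_comp_continuous _ _ (dot v) [set k | k < b]).
  exact: dot_continuous.
exact: open_lt.
Qed.

Lemma closure_ballP A z : closure A z <->
  forall r : R, 0 < r -> exists2 y, A y & forall i, `|z 0 i - y 0 i| < r.
Proof.
split=> [Az r r0|h].
  have [y [Ay /(ball_rowP _ _ r0)]] := Az _ (nbhsx_ballx z _ r0).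
  by exists y.
move=> B /nbhs_ballP[r/= r0 rB]; have [y Ay yr] := h r r0; exists y; split => //.
by apply: rB; apply/ball_rowP.
Qed.

Lemma open_ballP A x : open A -> A x ->
  exists2 r : R, 0 < r & forall y, (forall i, `|x 0 i - y 0 i| < r) -> A y.
Proof.
move=> oA Ax; have /nbhs_ballP[r/= r0 rA] : nbhs x A by exact: oA.
by exists r => // y h; apply: rA; apply/ball_rowP.
Qed.

(** A combination of y and of a limit point z of K is also a combination of a
    point z' of K near z and of a point y' near y. *)
Lemma convex_interior_segment K y z (t : R) : open K ->
  @convex_set R 'rV[R]_n K -> K y -> closure K z -> 0 < t -> t <= 1 ->
  K (t *: y + (1 - t) *: z).
Proof.
move=> oK cK Ky Kz t0 t1; have [r r0 yr] := open_ballP oK Ky.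
have [z' Kz' zz'] := (closure_ballP K z).1 Kz (t * r) (mulr_gt0 t0 r0).
pose y' := y + ((1 - t) / t) *: (z - z').
have -> : t *: y + (1 - t) *: z = t *: y' + (1 - t) *: z'.
  rewrite /y'; apply/rowP => i; rewrite !mxE; field; exact: lt0r_neq0.
apply: convex_setP => //; last exact: ltW.
apply: yr => i; rewrite !mxE.
rewrite opprD addNKr normrN normrM.
have t1' : `|(1 - t) / t| <= t^-1.
  rewrite normrM !ger0_norm ?invr_ge0 ?subr_ge0// ?(ltW t0)//.
  by rewrite ler_piMl ?invr_ge0 ?(ltW t0)//; lra.
have := zz' i; rewrite -ltr_pdivrMl// => h; apply: le_lt_trans h.
by rewrite ler_wpM2r.
Qed.

End convexity.

(** * Surface measure, prisms and pyramids *)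

Section surface.
Context (R : realType).

(** The bound of [lebesgue_sweep] holds in every chart, hence for the infimum. *)
Lemma lebesgue_sweep_surface n (h : 'rV[R]_n.+1) (M : R)
    (F : set 'rV[R]_n.+1) : 0 < M -> (forall i, `|h 0 i| <= M) -> closed F ->
  (lebesgue [set x | exists t : R, (0 <= t <= 1)%R /\ F (x + t *: h)%R] <=
   (n.+1%:R * M)%:E * surface_measure F)%E.
Proof.
move=> M0 hM cF; have k0 : 0 < n.+1%:R * M by rewrite mulr_gt0.
rewrite -lee_pdivrMl//; apply: le_ereal_inf_tmp => _ [a [V [VV Fa ->]]].
rewrite lee_pdivrMl//; have [e fr] := frame_of_rows VV.
apply: (le_trans (lebesgue_sweep h fr cF Fa)).
apply: lee_wpmul2r; first exact: lebesgue_ge0.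
by rewrite lee_fin dotC; apply: unit_dot_le => //; case: fr.
Qed.

(** If z' in A is close to z, then w + (z - z') is still in A, because A is
    relatively open in a hyperplane, and (z + w) / 2 is the midpoint of z' and
    w + (z - z'). *)
Lemma relatively_open_midpoint n (v : 'rV[R]_n) (b : R) (U A : set 'rV[R]_n) z w :
  open U -> A = hyperplane v b `&` U -> @convex_set R 'rV[R]_n A ->
  closure A z -> A w -> A (2^-1 *: z + 2^-1 *: w).
Proof.
move=> oU AE cA Az Aw; have Uw : U w by move: Aw; rewrite AE => -[].
have [r r0 wr] := open_ballP oU Uw.
have [z' Az' zz'] := (closure_ballP A z).1 Az _ r0.
have hz : hyperplane v b z.
  have : closure (hyperplane v b) z.
    by apply: closureS Az => x; rewrite AE => -[].
  by rewrite -(closure_id _).1//; exact: closed_hyperplane.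
have Aw' : A (w + (z - z')).
  rewrite AE; split.
    rewrite /hyperplane /= dotDr dotBr hz.
    by move: Az' Aw; rewrite AE => -[-> _] [-> _]; ring.
  by apply: wr => i; rewrite !mxE opprD addNKr normrN.
have := convex_setP cA Az' Aw' (_ : 0 <= 2^-1) (_ : 2^-1 <= 1).
have -> : 2^-1 *: z' + (1 - 2^-1) *: (w + (z - z')) = 2^-1 *: z + 2^-1 *: w.
  by apply/rowP => i; rewrite !mxE; field.
by apply; lra.
Qed.

(** The homothety of ratio 1/2 centred at a point of A maps the closure of A
    into A; the charts of A are also charts of its closure, because a point z
    of the closure is a combination of two points of A. *)
Lemma surface_closure n (A : set 'rV[R]_n.+1) : A !=set0 -> borel A ->
  (forall z w, closure A z -> A w -> A (2^-1 *: z + 2^-1 *: w)) ->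
  (surface_measure (closure A) <= (2 ^+ n)%:E * surface_measure A)%E.
Proof.
move=> [w Aw] mA mid; have k0 : 0 < 2 ^+ n :> R by rewrite exprn_gt0.
rewrite -lee_pdivrMl//; apply: le_ereal_inf_tmp => _ [a [V [VV Aa ->]]].
rewrite lee_pdivrMl//; have [s0 _ s0w] := Aa _ Aw.
apply: (@le_trans _ _ (lebesgue [set s : 'rV_n | closure A (a + s *m V)])).
  apply: ereal_inf_lbound; exists a, V; split => // z Az.
  have [s _ sz] := Aa _ (mid _ _ Az Aw); exists (2 *: s - s0) => //.
  rewrite mulmxBl -scalemxAl.
  have -> : z = 2 *: (2^-1 *: z + 2^-1 *: w) - w.
    by apply/rowP => i; rewrite !mxE; field.
  by rewrite -sz -s0w; apply/rowP => i; rewrite !mxE; ring.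
have := @lebesgue_dilation R n [set s | A (a + s *m V)] (2^-1 *: s0) 2^-1.
rewrite invrK => <- //; last exact: borel_affine.
apply: le_lebesgue => s /= As.
have := mid _ _ As Aw; rewrite -s0w; congr A.
by rewrite mulmxDl -!scalemxAl; apply/rowP => i; rewrite !mxE; field.
Qed.

(** The surface measure is an infimum over charts, so each chart bounds it. *)
Lemma surface_le_frame n (e a : 'rV[R]_n.+1) V (A : set 'rV[R]_n.+1) :
  frame e V -> (forall x, A x -> dot x e = dot a e) ->
  (surface_measure A <= lebesgue [set s | A (a + s *m V)%R])%E.
Proof.
move=> fr Ae; apply: ereal_inf_lbound; exists a, V; split => //.
  by case: fr.
move=> x /Ae xe; exists ((x - a) *m V^T) => //.
have := frame_decomp (x - a) fr; rewrite dotBl xe subrr scale0r add0r => <-.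
by rewrite addrC subrK.
Qed.

Lemma surface_ge0 n (A : set 'rV[R]_n) : (0 <= surface_measure A)%E.
Proof. by apply: le_ereal_inf_tmp => _ [a [V [_ _ ->]]]; exact: lebesgue_ge0. Qed.

Lemma surface_bounded_lty n (v : 'rV[R]_n.+1) (b M : R) (A : set 'rV[R]_n.+1) :
  v != 0 -> A `<=` hyperplane v b -> (forall x, A x -> forall i, `|x 0 i| <= M) ->
  (surface_measure A < +oo)%E.
Proof.
move=> v0 Av AM; pose e := (enorm v)^-1 *: v.
have ee : dot e e = 1 by exact: dot_normalize.
have [V fr] := frame_of_normal ee.
apply: (le_lt_trans (@surface_le_frame n e ((b / enorm v) *: e) V A fr _)).
  by move=> x /Av xb; rewrite dotZl ee mulr1 dotZr dotC xb mulrC.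
apply: (@lebesgue_bounded_lty _ _ _ (n.+1%:R * (M + `|b / enorm v|))) => s /AM sM i.
have [VV _ _] := fr; set a := _ *: e in sM.
have -> : s 0 i = dot (row i V) (a + s *m V - a).
  by rewrite addrC addKr dotE -row_mul trmx_mul mulmxA VV mul1mx !mxE.
apply: unit_dot_le => [|j].
  by rewrite dotE tr_row -row_mul mxE colE mulmxA VV mul1mx mxE !eqxx.
have -> : (a + s *m V - a) 0 j = (a + s *m V) 0 j - a 0 j by rewrite !mxE.
rewrite (le_trans (ler_normB _ _))// lerD//.
rewrite mxE normrM ler_piMr//.
by rewrite (le_trans (coord_le_enorm e j))// /enorm ee sqrtr1.
Qed.

(** The pyramid of apex c over S, restricted to the parameters t in (1/2, 1):
    its slices orthogonal to e are dilates of S by a factor at least 1/2, over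
    an interval of length delta / 2.  Staying away from the apex makes the
    bound on the slices uniform. *)
Lemma lebesgue_pyramid n (e c : 'rV[R]_n.+1) (delta : R)
    (U S P : set 'rV[R]_n.+1) : dot e e = 1 -> 0 < delta -> open U ->
  S = hyperplane e (dot e c + delta) `&` U ->
  P = [set x | exists t z, [/\ 2^-1 < t < 1, S z & x = c + t *: (z - c)]] ->
  open P /\
  ((delta / 2 * (2 ^+ n)^-1)%:E * surface_measure S <= lebesgue P)%E.
Proof.
move=> ee d0 oU SE PE; have d0' : delta != 0 by rewrite gt_eqF.
pose tau (x : 'rV[R]_n.+1) : R := dot e (x - c).
(* The projection of x from the apex onto the hyperplane of S. *)
pose g (x : 'rV[R]_n.+1) : 'rV[R]_n.+1 := c + (delta / tau x) *: (x - c).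
have PD x : P x <-> (delta / 2 < tau x < delta) /\ U (g x).
  rewrite PE /=; split=> [[t [z [/andP[t1 t2] Sz ->]]]|[/andP[t1 t2] Ugx]].
    have tE : tau (c + t *: (z - c)) = t * delta.
      move: Sz; rewrite SE => -[/= ez _].
      by rewrite /tau addrC addKr dotZr dotBr ez; ring.
    split; first by rewrite tE; apply/andP; split; nra.
    have t0 : t != 0 by rewrite gt_eqF//; lra.
    have -> : g (c + t *: (z - c)) = z.
      by rewrite /g tE; apply/rowP => i; rewrite !mxE; field; rewrite d0'.
    by move: Sz; rewrite SE => -[].
  have tx0 : 0 < tau x by apply: lt_trans t1; rewrite divr_gt0.
  have tx0' : tau x != 0 by rewrite gt_eqF.
  exists (tau x / delta), (g x); split.
  - by rewrite ltr_pdivlMr// ltr_pdivrMr// mul1r mulrC t1.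
  - rewrite SE; split => //; rewrite /hyperplane /= /g dotDr dotZr -/(tau x).
    by rewrite divfK// gt_eqF.
  - rewrite /g; move: (tau x) tx0' => k k0.
    by apply/rowP => i; rewrite !mxE; field; rewrite k0.
have ctau : continuous tau.
  rewrite (_ : tau = dot e - (fun=> dot e c)); last first.
    by apply/funext => x; rewrite /tau dotBr.
  move=> x; apply: continuousB; first exact: dot_continuous.
  exact: cst_continuous.
have oP : open P.
  rewrite openE => x /PD[/andP[t1 t2] Ugx].
  have tx0 : 0 < tau x by apply: lt_trans t1; rewrite divr_gt0.
  have cg : {for x, continuous g}.
    rewrite (_ : g = (fun=> c) + (fun x => (delta / tau x) *: (x - c))); last by [].
    apply: continuousD; first exact: cst_continuous.
    apply: continuousZ; last first.
      apply: (@continuousB _ _ _ id (fun=> c)); last exact: cst_continuous.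
      exact: cvg_id.
    apply: (@continuousM _ _ (fun=> delta) (fun x => (tau x)^-1)).
      exact: cst_continuous.
    by apply: continuousV; [rewrite gt_eqF|exact: ctau].
  have nU : nbhs x (g @^-1` U) by apply: cg; exact: open_nbhs_nbhs.
  have o1 : open (tau @^-1` [set k | delta / 2 < k]).
    by apply: open_comp_continuous => //; exact: open_gt.
  have o2 : open (tau @^-1` [set k | k < delta]).
    by apply: open_comp_continuous => //; exact: open_lt.
  have n1 : nbhs x (tau @^-1` [set k | delta / 2 < k]) by exact: open_nbhs_nbhs.
  have n2 : nbhs x (tau @^-1` [set k | k < delta]) by exact: open_nbhs_nbhs.
  rewrite /interior; near=> y; apply/PD; split; last by near: y.
  by apply/andP; split; near: y.
split=> //; have [V fr] := frame_of_normal ee.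
pose a := c + delta *: e.
have Sa x : S x -> dot x e = dot a e.
  rewrite SE => -[/= ex _]; rewrite dotC ex dotDl dotZl ee mulr1.
  by rewrite (dotC c).
have bS : borel S.
  rewrite SE; apply: borelI; last exact: borel_open.
  by apply: borel_closed; exact: closed_hyperplane.
pose J : set (measurableTypeR R) := `]delta / 2, delta[%classic.
have J1 : lebesgue_measure J = (delta / 2)%:E.
  rewrite /J lebesgue_measure_itv /= lte_fin ifT; last by lra.
  by rewrite -EFinD; congr EFin; field.
rewrite EFinM -muleA -J1 muleC.
have b0 : 0 < (2 ^+ n)^-1 :> R by rewrite invr_gt0 exprn_gt0.
apply: (lebesgue_frame_ge fr (a := c)) => //.
- exact: borel_open.
- exact: measurable_itv.
- by rewrite mule_ge0// ?surface_ge0// lee_fin ltW.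
move=> t; rewrite indicE; have [|] := boolP (t \in J); last first.
  by rewrite mule0 lebesgue_ge0.
rewrite inE /J /= in_itv/= mule1 => /andP[t1 t2].
have t0 : 0 < t by apply: lt_trans t1; rewrite divr_gt0.
pose r := delta / t; have r0 : 0 < r by rewrite divr_gt0.
apply: (@le_trans _ _ (lebesgue [set s | [set s | S (a + s *m V)] (0 + r *: s)])).
  rewrite lebesgue_dilation//; last exact: borel_affine.
  apply: lee_pmul; first by rewrite lee_fin ltW.
  - exact: surface_ge0.
  - rewrite lee_fin -exprVn lerXn2r ?nnegrE ?invr_ge0 ?ltW//.
    rewrite ltf_pV2 ?posrE// ltr_pdivrMr//.
    by move: (t : R) t1 => k; lra.
  - exact: (surface_le_frame fr Sa).
apply: le_lebesgue => s /=; rewrite add0r -scalemxAl => Ss.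
rewrite PE /=; exists (t / delta), (a + r *: (s *m V)); split => //.
  by rewrite ltr_pdivlMr// ltr_pdivrMr// mul1r mulrC t1.
have homothety (k : R) (w : 'rV_n.+1) : 0 < k -> c + k *: e + w =
    c + (k / delta) *: (c + delta *: e + (delta / k) *: w - c).
  move=> k0; apply/rowP => i; rewrite !mxE; field.
  by rewrite d0' gt_eqF.
exact: homothety.
Unshelve. all: by end_near. Qed.

End surface.

(** * Weighted sums of volumes *)

Section domination.
Context (R : realType).

(** Integrate the pointwise inequality. *)
Lemma sum_measure_le d (T : measurableType d) (mu : {measure set T -> \bar R})
    (I J : finType) (a : I -> R) (b : J -> R) (A : I -> set T) (B : J -> set T) :
  (forall i, 0 <= a i) -> (forall j, 0 <= b j) ->
  (forall i, measurable (A i)) -> (forall j, measurable (B j)) ->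
  (forall x, \sum_i a i * \1_(A i) x <= \sum_j b j * \1_(B j) x) ->
  (\sum_i (a i)%:E * mu (A i) <= \sum_j (b j)%:E * mu (B j))%E.
Proof.
move=> a0 b0 mA mB AB.
have sumE (K : finType) (c : K -> R) (C : K -> set T) :
    (forall i, 0 <= c i) -> (forall i, measurable (C i)) ->
    (\int[mu]_x (\sum_i (c i)%:E * (\1_(C i) x)%:E) =
     \sum_i (c i)%:E * mu (C i))%E.
  move=> c0 mC; rewrite ge0_integral_sum//; last 2 first.
  - by move=> i; apply: measurable_funeM; exact/measurable_EFinP.
  - by move=> i x _; rewrite mule_ge0// lee_fin.
  apply: eq_bigr => i _; rewrite ge0_integralZl//.
  - by rewrite integral_indic// setIT.
  - exact/measurable_EFinP.
  - by rewrite lee_fin.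
rewrite -!sumE//; apply: ge0_le_integral => //.
- by move=> x _; apply: sume_ge0 => i _; rewrite mule_ge0// lee_fin.
- by apply: emeasurable_sum => i; apply: measurable_funeM; exact/measurable_EFinP.
- by apply: emeasurable_sum => i; apply: measurable_funeM; exact/measurable_EFinP.
- move=> x _; under eq_bigr do rewrite -EFinM.
  by under [leRHS]eq_bigr do rewrite -EFinM; rewrite !sumEFin lee_fin.
Qed.

Definition vol n (A : set 'rV[R]_n) : R := fine (lebesgue A).

Definition in_box n (M : R) (A : set 'rV[R]_n) :=
  forall x, A x -> forall i, `|x 0 i| <= M.

Lemma volE n M (A : set 'rV[R]_n) : in_box M A -> lebesgue A = (vol A)%:E.
Proof.
by move=> /lebesgue_bounded_lty AM; rewrite /vol fineK// ge0_fin_numE// lebesgue_ge0.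
Qed.

Lemma vol_ge0 n (A : set 'rV[R]_n) : 0 <= vol A.
Proof. by apply: fine_ge0; exact: lebesgue_ge0. Qed.

Lemma vol_gt0 n M (A : set 'rV[R]_n) : in_box M A -> open A -> A !=set0 ->
  0 < vol A.
Proof.
by move=> AM oA A0; have := lebesgue_gt0 oA A0; rewrite (volE AM).
Qed.

Lemma in_boxS n M (A B : set 'rV[R]_n) : A `<=` B -> in_box M B -> in_box M A.
Proof. by move=> AB BM x /AB; exact: BM. Qed.

Lemma le_vol n M (A B : set 'rV[R]_n) : A `<=` B -> in_box M B ->
  vol A <= vol B.
Proof.
move=> AB BM; have AM := in_boxS AB BM.
by have := le_lebesgue AB; rewrite (volE AM) (volE BM).
Qed.

Lemma bounded_in_box n (A : set 'rV[R]_n) : bounded_set A ->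
  exists2 M : R, 0 < M & in_box M A.
Proof.
move=> [M [_ AM]]; exists (`|M| + 1); first by rewrite ltr_wpDl.
move=> x Ax i; have : `|x 0 i| <= `|x|.
  have /mapP[j Hj ->] : `|x 0 i| \in [seq `|x y.1 y.2| | y : 'I_1 * 'I_n].
    by apply/mapP; exists (ord0, i) => //=; rewrite mem_enum.
  by rewrite [leRHS]/Num.norm /= mx_normrE; apply/bigmax_geP; right => /=; exists j.
move=> /le_trans; apply; apply: AM Ax.
by rewrite (le_lt_trans (ler_norm M))// ltrDl.
Qed.

Lemma sum_vol_le n M (I J : finType) (a : I -> R) (b : J -> R)
    (A : I -> set 'rV[R]_n) (B : J -> set 'rV[R]_n) :
  (forall i, 0 <= a i) -> (forall j, 0 <= b j) ->
  (forall i, in_box M (A i)) -> (forall j, in_box M (B j)) ->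
  (forall i, borel (A i)) -> (forall j, borel (B j)) ->
  (forall x, \sum_i a i * \1_(A i) x <= \sum_j b j * \1_(B j) x) ->
  \sum_i a i * vol (A i) <= \sum_j b j * vol (B j).
Proof.
move=> a0 b0 AM BM mA mB AB.
rewrite -lee_fin -!sumEFin.
under eq_bigr do rewrite EFinM -(volE (AM _)) lebesgueE//.
under [leRHS]eq_bigr do rewrite EFinM -(volE (BM _)) lebesgueE//.
apply: sum_measure_le => // t; have := AB (row_of t).
by under eq_bigr do rewrite !indicE; under [leRHS]eq_bigr do rewrite !indicE.
Qed.

End domination.

(** * The two sides of a hyperplane *)

Section sides_of_hyperplane.
Context (R : realType) (n : nat).
Implicit Types (K L S U : set 'rV[R]_n) (v x y z : 'rV[R]_n).

Lemma open_ray U z v : open U -> U z ->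
  exists2 r : R, 0 < r & forall t, 0 <= t <= r -> U (z + t *: v).
Proof.
move=> oU Uz; have [r r0 zr] := open_ballP oU Uz.
have [M M0 vM] : exists2 M : R, 0 < M & forall i, `|v 0 i| <= M.
  exists (enorm v + 1) => [|i]; first by rewrite ltr_wpDl ?enorm_ge0.
  by rewrite (le_trans (coord_le_enorm v i))// lerDl.
exists (r / (2 * M)); first by rewrite divr_gt0// mulr_gt0.
move=> t /andP[t0 t1]; apply: zr => i; rewrite !mxE opprD addNKr normrN normrM.
rewrite ger0_norm//; apply: (@le_lt_trans _ _ (r / (2 * M) * M)).
  by rewrite ler_pM.
have -> : r / (2 * M) * M = r / 2 by field; rewrite gt_eqF.
lra.
Qed.

(** If y in K were in the hyperplane, prolonging the segment from y to z in S
    slightly beyond z would stay in S, hence in the closure of K, and z would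
    lie in the open segment joining y to a limit point of K, hence in K. *)
Lemma hyperplane_avoids v b U S K y : open K -> @convex_set R 'rV[R]_n K ->
  open U -> S = hyperplane v b `&` U -> S !=set0 -> S `<=` closure K ->
  (forall z, S z -> ~ K z) -> K y -> dot v y != b.
Proof.
move=> oK cK oU SE [z Sz] SK nSK Ky; apply/eqP => vy.
have [vz Uz] : dot v z = b /\ U z by move: Sz; rewrite SE.
have [r r0 Ur] := open_ray (z - y) oU Uz.
have Sz' : S (z + r *: (z - y)).
  rewrite SE; split; last by apply: Ur; rewrite lexx ltW.
  by rewrite /hyperplane /= dotDr dotZr dotBr vy vz subrr mulr0 addr0.
apply: (nSK _ Sz).
have r1 : 1 + r != 0 by rewrite gt_eqF//; lra.
have -> : z = (r / (1 + r)) *: y + (1 - r / (1 + r)) *: (z + r *: (z - y)).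
  by apply/rowP => i; rewrite !mxE; field.
apply: convex_interior_segment => //; first exact: SK.
  by rewrite divr_gt0//; lra.
by rewrite ler_pdivrMr; lra.
Qed.

(** From a point z of S, the directions y - z and k (y' - z) have the same
    normal component, for a suitable k > 0; they differ by a vector w of the
    hyperplane.  A small multiple of y - z added to z gives a point of K, which
    also lies between y' and a point z + h w of S, hence in L. *)
Lemma same_side_meet v b U S K L y y' : open K -> @convex_set R 'rV[R]_n K ->
  open L -> @convex_set R 'rV[R]_n L ->
  open U -> S = hyperplane v b `&` U -> S !=set0 ->
  S `<=` closure K -> S `<=` closure L -> K y -> L y' ->
  0 < (dot v y - b) * (dot v y' - b) -> K `&` L !=set0.
Proof.
move=> oK cK oL cL oU SE [z Sz] SK SL Ky Ly' pos.
have [vz Uz] : dot v z = b /\ U z by move: Sz; rewrite SE.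
set p := dot v y - b in pos; set q := dot v y' - b in pos.
have q0 : q != 0 by apply: contraTN pos => /eqP ->; rewrite mulr0 ltxx.
pose k := p / q; have k0 : 0 < k.
  have -> : k = p * q * q^-1 ^+ 2 by rewrite /k; field.
  by rewrite mulr_gt0// exprn_even_gt0//= invr_eq0.
pose w := (y - z) - k *: (y' - z).
have vw : dot v w = 0.
  by rewrite dotBr dotZr !dotBr vz -/p -/q /k divfK// subrr.
have [r r0 Ur] := open_ray w oU Uz.
pose h := Num.min r 1; have h0 : 0 < h by rewrite lt_min r0 ltr01.
have hr : h <= r by rewrite ge_min lexx.
have h1 : h <= 1 by rewrite ge_min lexx orbT.
have Sz' : S (z + h *: w).
  rewrite SE; split; last by apply: Ur; rewrite hr ltW.
  by rewrite /hyperplane /= dotDr dotZr vw vz mulr0 addr0.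
have hk : 0 < h * k by rewrite mulr_gt0.
have hk0 : 1 + h * k != 0 by rewrite gt_eqF//; lra.
pose e := h / (1 + h * k); pose d := h * k / (1 + h * k).
have e01 : 0 < e <= 1.
  by rewrite /e divr_gt0 ?ler_pdivrMr//=; lra.
have d01 : 0 < d <= 1.
  by rewrite /d divr_gt0 ?ler_pdivrMr//=; lra.
exists (e *: y + (1 - e) *: z); split.
  by case/andP: e01 => ? ?; apply: convex_interior_segment => //; exact: SK.
have -> : e *: y + (1 - e) *: z = d *: y' + (1 - d) *: (z + h *: w).
  by apply/rowP => i; rewrite /w /e /d !mxE; field.
by case/andP: d01 => ? ?; apply: convex_interior_segment => //; exact: SL.
Qed.

(** The part of w that is tangent to the hyperplane is, up to scaling,
    the difference of two points of S; it is then orthogonal to w and to v,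
    hence to itself. *)
Lemma orthogonal_to_relatively_open v b U S w : v != 0 -> open U ->
  S = hyperplane v b `&` U -> S !=set0 -> orthogonal_to w S ->
  w = (dot v w / dot v v) *: v.
Proof.
move=> v0 oU SE [z Sz] wS; set k := dot v w / dot v v.
have [vz Uz] : dot v z = b /\ U z by move: Sz; rewrite SE.
have vv : dot v v != 0 by rewrite dot_eq0.
pose u := w - k *: v.
have vu : dot v u = 0 by rewrite dotBr dotZr /k divfK// subrr.
have [r r0 Ur] := open_ray u oU Uz.
have Sz' : S (z + r *: u).
  rewrite SE; split; last by apply: Ur; rewrite lexx ltW.
  by rewrite /hyperplane /= dotDr dotZr vu vz mulr0 addr0.
have := wS _ _ Sz' Sz; rewrite addrC addKr dotZr => /eqP.
rewrite mulf_eq0 gt_eqF//= => /eqP wu.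
have : dot u u == 0 by rewrite {1}/u dotBl dotZl vu wu mulr0 subrr.
by rewrite dot_eq0 subr_eq0 => /eqP.
Qed.

End sides_of_hyperplane.

(** * Faces, sides and pyramids of an admissible mesh *)

Section mesh_geometry.
Context (R : realType) (n : nat) (Omega : set 'rV[R]_n.+1) (M : mesh R n.+1).
Hypothesis adm : admissible Omega M.
Implicit Types (K L : cell M) (s : edge M).

Lemma interfaceC s K L : interface s K L -> interface s L K.
Proof. by move=> [KL ?]; split; [rewrite eq_sym|rewrite setIC]. Qed.

Lemma volume_disj K L x : volume K x -> volume L x -> K = L.
Proof.
by move=> Kx Lx; apply: (volume_disjoint adm) => //; exists x.
Qed.

Lemma volume_closure_disj K L x : volume K x -> closure (volume L) x -> K = L.
Proof.
move=> Kx Lx; have nK : nbhs x (volume K).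
  by apply: open_nbhs_nbhs; split => //; exact: (volume_open adm).
by have [y [Ly Ky]] := Lx _ nK; exact: (volume_disj Ky Ly).
Qed.

Lemma interface_closure s K L : interface s K L ->
  face s `<=` closure (volume K).
Proof.
move=> [_ KL] x sx; have : closure (face s) x by exact: subset_closure.
by rewrite -KL => -[].
Qed.

Lemma interface_notin s K L x : interface s K L -> face s x -> ~ volume K x.
Proof.
move=> KL sx Kx; have Lx := interface_closure (interfaceC KL) sx.
by case: KL => /eqP KL _; exact/KL/(volume_closure_disj Kx Lx).
Qed.

Lemma interface_edge_of s K L : interface s K L -> edge_of K s.
Proof.
move=> KL x sx; split; first exact: (interface_closure KL).
by rewrite (interior_id _).1; [exact: (interface_notin KL)|exact: (volume_open adm)].
Qed.

(** Each side of the hyperplane that carries the face contains the centre of at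
    most one cell with this face in its closure, by [same_side_meet].  Hence
    the choice made by [sides] does not matter. *)
Lemma interface_unique s K L K' L' : interface s K L -> interface s K' L' ->
  (K' = K /\ L' = L) \/ (K' = L /\ L' = K).
Proof.
move=> KL KL'; have [v [b [U [v0 oU sE]]]] := face_hyperplane adm s.
pose side (J : cell M) := 0 < dot v (center J) - b.
have s0 := face_nonempty adm s.
(* The centre of a cell next to s is not in the hyperplane, so that not being
   on its positive side means being on the negative one. *)
have nb J J' : interface s J J' -> dot v (center J) - b != 0.
  move=> JJ'; rewrite subr_eq0.
  have JJn z : face s z -> ~ volume J z by exact: interface_notin JJ'.
  exact: (hyperplane_avoids (@volume_open _ _ _ _ adm J) (@volume_convex _ _ _ _ adm J) oU sE s0
    (interface_closure JJ') JJn (center_in_volume adm J)).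
have same J1 J1' J2 J2' : interface s J1 J1' -> interface s J2 J2' ->
    side J1 = side J2 -> J1 = J2.
  move=> JJ1 JJ2 sJ; have h1 := nb _ _ JJ1; have h2 := nb _ _ JJ2.
  have [|x [J1x J2x]] := same_side_meet (@volume_open _ _ _ _ adm J1)
    (@volume_convex _ _ _ _ adm J1) (@volume_open _ _ _ _ adm J2) (@volume_convex _ _ _ _ adm J2)
    oU sE s0 (interface_closure JJ1) (interface_closure JJ2)
    (center_in_volume adm J1) (center_in_volume adm J2); last first.
    exact: volume_disj J1x J2x.
  move: sJ h1 h2; rewrite /side.
  set p := _ - b; set q := _ - b => + p0 q0.
  have [pp|pp] := ltP 0 p; first by move=> /esym qp; rewrite mulr_gt0.
  move=> /esym/negbT; rewrite -leNgt => qq.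
  by rewrite nmulr_lgt0 lt_neqAle ?p0 ?q0.
have opp J J' : interface s J J' -> side J = ~~ side J'.
  move=> JJ'; have : side J != side J'.
    apply/eqP => sJ; case: (JJ') => /eqP + _; apply.
    exact: (same _ _ _ _ JJ' (interfaceC JJ') sJ).
  by case: (side J); case: (side J').
have [sK|sK] := eqVneq (side K') (side K); [left|right].
  split; first exact: (same _ _ _ _ KL' KL sK).
  apply: (same _ _ _ _ (interfaceC KL') (interfaceC KL)).
  by move: sK; rewrite (opp _ _ KL) (opp _ _ KL') => /negb_inj.
move: sK; rewrite (opp _ _ KL) => sK.
have sK' : side K' = side L by move: sK; case: (side K'); case: (side L).
split; first exact: (same _ _ _ _ KL' (interfaceC KL) sK').
apply: (same _ _ _ _ (interfaceC KL') KL).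
by rewrite (opp _ _ KL) -sK' (opp _ _ KL') negbK.
Qed.

Lemma sidesP s KL : sides s = Some KL -> interface s KL.1 KL.2.
Proof. by rewrite /sides; case: pickP => // KL' /asboolP h [<-]. Qed.

Lemma interface_sides s K L : interface s K L ->
  exists2 KL, sides s = Some KL & KL = (K, L) \/ KL = (L, K).
Proof.
move=> KL; rewrite /sides; case: pickP => [[K' L'] /asboolP/= h|/(_ (K, L))].
  exists (K', L') => //.
  by have [[-> ->]|[-> ->]] := interface_unique KL h; [left|right].
by move=> /asboolPn.
Qed.

(** The line through the two centres meets the face at the foot of the
    perpendicular from the centre of K: the distance delta to the hyperplane is
    attained in the face, and so bounds [edist]. *)
Lemma interface_frame s K L : interface s K L ->
  exists e delta U, [/\ dot e e = 1, 0 < delta, open U,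
    face s = hyperplane e (dot e (center K) + delta) `&` U &
    edist (center K) (face s) <= delta].
Proof.
move=> KL; have [v [b [U [v0 oU sE]]]] := face_hyperplane adm s.
have s0 := face_nonempty adm s.
have [[f [[t _ tf] sf]] ortho] := interface_orthogonal adm KL.
set w := center L - center K in tf ortho.
have wv := orthogonal_to_relatively_open v0 oU sE s0 ortho.
set k := _ / _ in wv.
(* f is where the line of the centres crosses the face. *)
pose g := f - center K.
have gE : g = (t * k) *: v by rewrite /g -tf addrC addKr wv scalerA.
have g0 : g != 0.
  rewrite subr_eq0; apply/eqP => fK; apply: (interface_notin KL sf).
  by rewrite fK; exact: (center_in_volume adm).
pose delta := enorm g; have d0 : 0 < delta by exact: enorm_gt0.
pose e := delta^-1 *: g.
have ee : dot e e = 1 by exact: dot_normalize.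
have eg : dot e g = delta.
  by rewrite dotZl -enormE expr2 mulrA mulVf ?mul1r// gt_eqF.
exists e, delta, U; split => //.
- have ek : e = (delta^-1 * (t * k)) *: v by rewrite /e gE scalerA.
  have ke0 : delta^-1 * (t * k) != 0.
    apply: contraNneq (oner_neq0 R) => ke0.
    by rewrite -ee ek ke0 scale0r dot0l.
  have bE : dot e (center K) + delta = delta^-1 * (t * k) * b.
    have [vf _] : dot v f = b /\ U f by move: sf; rewrite sE.
    have fE : center K + g = f by rewrite /g addrC subrK.
    by rewrite -[X in _ + X = _]eg -dotDr fE ek dotZl vf.
  rewrite sE; congr (_ `&` U); apply/seteqP; split => x; rewrite /hyperplane /=.
    by move=> vx; rewrite bE ek dotZl vx.
  by rewrite bE ek dotZl => /(mulfI ke0).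
- apply: (@le_trans _ _ (enorm (center K - f))).
    apply: ge_inf; last by exists f.
    by exists 0 => _ [y _ <-]; exact: enorm_ge0.
  by rewrite -opprB -scaleN1r enormZ normrN normr1 mul1r.
Qed.

Hypothesis bounded : bounded_set Omega.

Lemma closure_in_box : exists2 m : R, 0 < m & in_box m (closure Omega).
Proof.
have [m m0 Om] := bounded_in_box bounded.
exists (m + 1); first by rewrite addr_gt0.
move=> x /closure_ballP/(_ 1 ltr01)[y /Om ym xy] i.
rewrite -[x 0 i](subrK (y 0 i)) (le_trans (ler_normD _ _))// addrC lerD//.
exact/ltW/xy.
Qed.

Lemma volume_in_box m K : in_box m (closure Omega) -> in_box m (volume K).
Proof.
apply: in_boxS => x /(volume_sub adm); exact: subset_closure.
Qed.

Lemma face_in_box m s : in_box m (closure Omega) -> in_box m (face s).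
Proof. apply: in_boxS; exact: (face_sub adm). Qed.

Definition area s : R := fine (surface_measure (face s)).

Lemma areaE s : surface_measure (face s) = (area s)%:E.
Proof.
have [m m0 Om] := closure_in_box.
have [v [b [U [v0 oU sE]]]] := face_hyperplane adm s.
rewrite /area fineK// ge0_fin_numE ?surface_ge0//.
apply: (surface_bounded_lty v0 (b := b) (M := m)); first by rewrite sE => x [].
exact: face_in_box.
Qed.

Lemma area_ge0 s : 0 <= area s.
Proof. by apply: fine_ge0; exact: surface_ge0. Qed.

Lemma borel_face s : borel (face s).
Proof.
have [v [b [U [v0 oU ->]]]] := face_hyperplane adm s.
apply: borelI; last exact: borel_open.
by apply: borel_closed; exact: closed_hyperplane.
Qed.

Lemma surface_closure_face s :
  (surface_measure (closure (face s)) <= (2 ^+ n * area s)%:E)%E.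
Proof.
rewrite EFinM -areaE; apply: surface_closure.
- exact: (face_nonempty adm).
- exact: borel_face.
move=> z w; have [v [b [U [v0 oU sE]]]] := face_hyperplane adm s.
exact: (relatively_open_midpoint oU sE (@face_convex _ _ _ _ adm s)).
Qed.

Lemma volume_ray K z t : boundary (volume K) z -> 0 < t < 1 ->
  volume K (center K + t *: (z - center K)).
Proof.
move=> [Kz _] /andP[t0 t1].
have -> : center K + t *: (z - center K) =
    (1 - t) *: center K + (1 - (1 - t)) *: z.
  by apply/rowP => i; rewrite !mxE; ring.
apply: convex_interior_segment => //; [exact: (volume_open adm)|
  exact: (volume_convex adm)|exact: (center_in_volume adm)| |]; lra.
Qed.

(** A cell is star-shaped with respect to its centre, so an open ray from the
    centre meets the boundary at most once: the points before a boundary point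
    are interior. *)
Lemma boundary_ray_unique K z z' t t' : boundary (volume K) z ->
  boundary (volume K) z' -> 0 < t < 1 -> 0 < t' < 1 ->
  center K + t *: (z - center K) = center K + t' *: (z' - center K) -> z = z'.
Proof.
have notin x : boundary (volume K) x -> ~ volume K x.
  by move=> [_]; rewrite (interior_id _).1//; exact: (volume_open adm).
have lt_absurd x x' r r' : boundary (volume K) x -> boundary (volume K) x' ->
    0 < r -> r < r' -> r *: (x - center K) = r' *: (x' - center K) -> False.
  move=> Kx Kx' r0 rr' E; apply: (notin _ Kx').
  have r'0 : 0 < r' by apply: lt_trans rr'.
  have -> : x' = center K + (r / r') *: (x - center K).
    rewrite mulrC -scalerA E scalerA mulVf ?gt_eqF// scale1r.
    by rewrite addrC subrK.
  by apply: volume_ray => //; rewrite divr_gt0//= ltr_pdivrMr// mul1r.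
move=> Kz Kz' /andP[t0 t1] /andP[t'0 t'1] /addrI E.
have [tt'|tt'|tt'] := ltgtP t t'.
- by case: (lt_absurd z z' t t').
- by case: (lt_absurd z' z t' t).
- by move: E; rewrite -tt' => /scalerI; rewrite gt_eqF// => /(_ isT)/addIr.
Qed.

(** Only the half of the pyramid that is next to its base, as in
    [lebesgue_pyramid]. *)
Definition pyramid K s : set 'rV[R]_n.+1 := [set x | exists t z,
  [/\ 2^-1 < t < 1, face s z & x = center K + t *: (z - center K)]].

Lemma pyramid_sub K s : edge_of K s -> pyramid K s `<=` volume K.
Proof.
move=> Ks x [t [z [/andP[t0 t1] /Ks Kz ->]]].
by apply: volume_ray => //; rewrite t1 andbT; lra.
Qed.

Lemma pyramid_disj K s s' x : edge_of K s -> edge_of K s' ->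
  pyramid K s x -> pyramid K s' x -> s = s'.
Proof.
move=> Ks Ks' [t [z [/andP[t0 t1] sz xE]]] [t' [z' [/andP[t'0 t'1] sz' xE']]].
have zz' : z = z'.
  apply: (@boundary_ray_unique K z z' t t').
  - exact: Ks.
  - exact: Ks'.
  - by rewrite t1 andbT; lra.
  - by rewrite t'1 andbT; lra.
  - by rewrite -xE.
by apply: (face_disjoint adm) => //; exists z; split => //; rewrite zz'.
Qed.

Lemma pyramid_vol K L s : interface s K L ->
  open (pyramid K s) /\
  area s * edist (center K) (face s) <= 2 ^+ n.+1 * vol (pyramid K s).
Proof.
move=> KL; have [e [delta [U [ee d0 oU sE ed]]]] := interface_frame KL.
have [oP] := lebesgue_pyramid ee d0 oU sE erefl; rewrite -/(pyramid K s) => vP.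
split=> //; have [m m0 Om] := closure_in_box.
have Pm : in_box m (pyramid K s).
  apply: in_boxS (volume_in_box (K := K) Om); apply: pyramid_sub.
  exact: interface_edge_of KL.
move: vP; rewrite areaE (volE Pm) -EFinM lee_fin => vP.
apply: (@le_trans _ _ (area s * delta)); first by rewrite ler_wpM2l// area_ge0.
have k0 : 0 < 2 ^+ n :> R by rewrite exprn_gt0.
have -> : area s * delta = 2 ^+ n.+1 * (delta / 2 / 2 ^+ n * area s).
  by rewrite exprS; field; rewrite gt_eqF.
by rewrite ler_wpM2l// exprn_ge0.
Qed.

(** The pyramids over the faces of K are disjoint subsets of K
    ([pyramid_disj]). *)
Lemma sum_pyramids K (P : pred (edge M)) :
  (forall s, P s -> exists L, interface s K L) ->
  \sum_(s | P s) area s * edist (center K) (face s) <=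
  2 ^+ n.+1 * vol (volume K).
Proof.
move=> PK; have [m m0 Om] := closure_in_box.
apply: (@le_trans _ _ (2 ^+ n.+1 * \sum_(s | P s) vol (pyramid K s))).
  rewrite big_distrr /=; apply: ler_sum => s /PK[L KL].
  by have [_] := pyramid_vol KL.
rewrite ler_wpM2l ?exprn_ge0//.
have Pedge s : P s -> edge_of K s by move=> /PK[L]; exact: interface_edge_of.
pose A s := if P s then pyramid K s else set0.
have := @sum_vol_le R n.+1 m (edge M) 'I_1 (fun=> 1) (fun=> 1) A
  (fun=> volume K).
rewrite big_ord1 mul1r => h; apply: (le_trans _ (h _ _ _ _ _ _ _)) => //.
- by rewrite big_mkcond; apply: ler_sum => s _; rewrite /A; case: ifP;
    rewrite ?mul1r ?vol_ge0.
- move=> s; rewrite /A; case: ifP => [Ps|_]; last by move=> x [].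
  apply: in_boxS (volume_in_box (K := K) Om); apply: pyramid_sub; exact: Pedge.
- by move=> _; exact: volume_in_box.
- move=> s; rewrite /A; case: ifP => [/PK[L KL]|_]; last by rewrite /borel preimage_set0.
  by apply: borel_open; have [] := pyramid_vol KL.
- by move=> _; apply: borel_open; exact: (volume_open adm).
move=> x; rewrite big_ord1 mul1r.
have [[s [Ps sx]]|nx] := pselect (exists s, P s /\ pyramid K s x).
  rewrite (bigD1 s)//= big1 => [|s' ss'].
    rewrite addr0 mul1r /A Ps !indicE !mem_set//.
    by apply: (pyramid_sub (Pedge _ Ps)).
  rewrite mul1r indicE memNset// /A; case: ifP => [Ps' s'x|_ []].
  by move: ss'; rewrite (pyramid_disj (Pedge _ Ps') (Pedge _ Ps) s'x sx) eqxx.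
rewrite big1 ?indicE// => s _; rewrite mul1r indicE memNset// /A.
by case: ifP => [Ps sx|_ []]; apply: nx; exists s.
Qed.

End mesh_geometry.

(** * Jumps along a segment *)

Section chains.
Context (R : realType) (T : finType).
Implicit Types (x y : T) (v : T -> R) (p : seq T).

Lemma path_jumps v x p :
  `|v x - v (last x p)| <= \sum_(q <- zip (belast x p) p) `|v q.1 - v q.2|.
Proof.
elim: p x => [|y p IH] x /=; first by rewrite big_nil subrr normr0.
rewrite big_cons /=; apply: le_trans (lerD (lexx _) (IH y)).
by rewrite (le_trans _ (ler_normD _ _))// addrA subrK.
Qed.

Lemma path_zip (e : rel T) x p : path e x p ->
  forall q, q \in zip (belast x p) p -> e q.1 q.2.
Proof.
elim: p x => [//|y p IH] x /= /andP[xy yp] q.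
by rewrite inE => /predU1P[-> //|]; exact: IH.
Qed.

(** The path can be taken without repeated vertices; then its steps are distinct
    pairs, and each of them is a term of the sum on the right. *)
Lemma connect_jumps v (e : rel T) x y : connect e x y ->
  `|v x - v y| <= \sum_(q : T * T | e q.1 q.2) `|v q.1 - v q.2|.
Proof.
move=> /connectP[p0 xp0 ->]; case: (shortenP xp0) => p xp up _.
apply: (le_trans (path_jumps v x p)).
rewrite big_uniq /=; last first.
  apply: (@map_uniq _ _ fst); rewrite -/unzip1 unzip1_zip ?size_belast//.
  by move: up; rewrite lastI rcons_uniq => /andP[].
rewrite big_mkcond [leRHS]big_mkcond; apply: ler_sum => q _.
case: ifP => [qz|_]; first by rewrite (path_zip xp qz).
by case: ifP.
Qed.

(** Relate two closed sets of the cover when they meet.  In the connected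
    interval, the union of those connected to C x and the union of the others
    are closed, disjoint and cover everything, so the second one is empty. *)
Lemma closed_cover_jumps v (C : T -> set R) x y :
  (forall z, closed (C z)) ->
  (forall t, 0 <= t <= 1 -> exists z, C z t) -> C x 0 -> C y 1 ->
  `|v x - v y| <= \sum_(q : T * T |
     `[< exists t, 0 <= t <= 1 /\ (C q.1 t /\ C q.2 t) >]) `|v q.1 - v q.2|.
Proof.
move=> cC cov Cx Cy.
pose e : rel T := fun a b => `[< exists t, 0 <= t <= 1 /\ (C a t /\ C b t) >].
apply: (@connect_jumps v e).
pose U (P : pred T) := \bigcup_(z in [set z | P z]) C z.
have closedU P : closed (U P) by apply: closed_bigcup => //; exact: finite_finset.
pose B := `[0, 1]%classic `&` U (connect e x).
have I01 t : `[0, 1]%classic t = (0 <= t <= 1) :> Prop by rewrite /= in_itv.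
have BE : B = `[0, 1]%classic.
  apply: (@segment_connected R 0 1).
  - exists 0; split; first by rewrite I01 lexx ler01.
    by exists x => //=; exact: connect0.
  - exists (~` U (predC (connect e x))); first exact/closed_openC/closedU.
    apply/seteqP; split=> t [t01 Ut]; split => //.
      case: Ut => z xz Czt [z' /= xz' Cz't]; move/negP: xz'; apply.
      apply: connect_trans xz _; apply: connect1; apply/asboolP.
      by exists t; rewrite -I01.
    have [z Czt] : exists z, C z t by apply: cov; rewrite -I01.
    exists z => //=; apply: contrapT => /negP xz; apply: Ut.
    by exists z.
  - by exists (U (connect e x)).
have [_ [z xz Cz1]] : B 1 by rewrite BE I01 lexx ler01.
apply: connect_trans xz _; apply: connect1; apply/asboolP.
by exists 1; rewrite lexx ler01.
Qed.

End chains.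

(** * Sets of pairs (base point, direction) *)

Section segments.
Context (R : realType) (n : nat).
Implicit Types (A F : set 'rV[R]_n).
Notation tup := (n.-tuple (measurableTypeR R)).

Lemma affine_continuous (x h : 'rV[R]_n) : continuous (fun t : R => x + t *: h).
Proof.
move=> t; apply: (@continuousD _ _ _ (fun=> x) (fun t : R => t *: h)).
  exact: cst_continuous.
by apply: (@continuousZr_tmp _ _ _ id); exact: cvg_id.
Qed.

Lemma lsubmx_continuous m : continuous (fun y : 'rV[R]_(m + n) => lsubmx y).
Proof.
move=> y B /nbhs_ballP[r/= r0 rB]; apply/nbhs_ballP; exists r => // z [_ yz].
by apply: rB; split => // i j; rewrite !mxE; exact: yz.
Qed.

Lemma rsubmx_continuous m : continuous (fun y : 'rV[R]_(n + m) => rsubmx y).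
Proof.
move=> y B /nbhs_ballP[r/= r0 rB]; apply/nbhs_ballP; exists r => // z [_ yz].
by apply: rB; split => // i j; rewrite !mxE; exact: yz.
Qed.

(** [closed_segment_hits] in the space of dimension 2n of the pairs (x, h). *)
Lemma measurable_segment_hits F : closed F ->
  measurable [set z : tup * tup |
    exists t : R, 0 <= t <= 1 /\ F (row_of z.1 + t *: row_of z.2)].
Proof.
move=> cF.
pose G := [set y : 'rV[R]_(n + n) |
  exists t : R, 0 <= t <= 1 /\ F (lsubmx y + t *: rsubmx y)].
have cG : closed G.
  by apply: closed_segment_hits => //; [exact: lsubmx_continuous|
    exact: rsubmx_continuous].
have -> : [set z : tup * tup |
    exists t : R, 0 <= t <= 1 /\ F (row_of z.1 + t *: row_of z.2)] =
    (fun z : tup * tup => row_mx (row_of z.1) (row_of z.2)) @^-1` G.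
  by apply/seteqP; split=> z [t [t01 Ft]]; exists t; split => //;
    move: Ft; rewrite row_mxKl row_mxKr.
apply: borel_comp; last exact: borel_closed.
move=> i; case: (split_ordP i) => j ->.
  rewrite (_ : (fun _ => _) = fun z : tup * tup => row_of z.1 0 j).
    exact: measurable_row_of_fst.
  by apply/funext => z; rewrite row_mxEl.
rewrite (_ : (fun _ => _) = fun z : tup * tup => row_of z.2 0 j).
  exact: measurable_row_of_snd.
by apply/funext => z; rewrite row_mxEr.
Qed.

Lemma measurable_fst_in A : borel A ->
  measurable [set z : tup * tup | A (row_of z.1)].
Proof. by move=> mA; apply: (borel_comp _ mA) => i; exact: measurable_row_of_fst. Qed.

Lemma measurable_sum_in A : borel A ->
  measurable [set z : tup * tup | A (row_of z.1 + row_of z.2)].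
Proof.
move=> mA; apply: (borel_comp _ mA) => i; apply: measurable_addmx => k.
  exact: measurable_row_of_fst.
exact: measurable_row_of_snd.
Qed.

(** For fixed x the admissible h form a translate of B. *)
Lemma pair_measure A B : borel A -> borel B ->
  (lebesgue_tuple R n \x lebesgue_tuple R n)%E
    [set z | A (row_of z.1) /\ B (row_of z.1 + row_of z.2)] =
  (lebesgue B * lebesgue A)%E.
Proof.
move=> mA mB; rewrite (lebesgueE mA); apply: product_measure_sections => //.
- by apply: measurableI; [exact: measurable_fst_in|exact: measurable_sum_in].
- exact: lebesgue_ge0.
move=> t; rewrite indicE; have [|] := boolP (t \in _); rewrite ?inE/= => tA.
  rewrite mule1 -(lebesgue_shift (row_of t) mB) lebesgueE; last exact: borel_shift.
  congr (lebesgue_tuple R n _); apply/seteqP; rewrite /xsection.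
  by split=> s /=; rewrite inE /= addrC => // -[].
rewrite mule0 (_ : xsection _ t = set0) ?measure0//.
rewrite -subset0 => s; rewrite /xsection /= inE/= => -[/=].
by rewrite notin_setE in tA.
Qed.

End segments.

(** * The double integral on a convex piece *)

Section convex_pieces.
Context (R : realType) (n : nat) (Omega : set 'rV[R]_n.+1) (M : mesh R n.+1).
Hypotheses (adm : admissible Omega M) (bounded : bounded_set Omega).
Hypothesis Omega_open : open Omega.
Variable m : R.
Hypotheses (m_gt0 : 0 < m) (box : in_box m (closure Omega)).
Implicit Types (K L : cell M) (s : edge M) (v : cell M -> R).

(** The discrete total variation, that is the seminorm for p = 1. *)
Definition jumps v : R := \sum_(s : edge M | `[< interior_edge Omega s >])
  if sides s is Some KL then area s * `|v KL.1 - v KL.2| else 0.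

(** K and L have at most one common face; a sum spares choosing it. *)
Definition contact K L : R :=
  \sum_(s : edge M | `[< interior_edge Omega s /\ interface s K L >]) area s.

Lemma contact_ge0 K L : 0 <= contact K L.
Proof. by apply: sumr_ge0 => s _; exact: area_ge0. Qed.

(** Every interface is counted for both orders of its two cells, whence the
    factor 2. *)
Lemma sum_contact v :
  \sum_(q : cell M * cell M) `|v q.1 - v q.2| * contact q.1 q.2 <= 2 * jumps v.
Proof.
under eq_bigr do rewrite big_distrr/= big_mkcond/=.
rewrite exchange_big/= /jumps big_distrr/= [leRHS]big_mkcond.
apply: ler_sum => s _; case: asboolP => [s_int|s_ext]; last first.
  by rewrite big1// => q _; case: asboolP => // -[].
have [[[K L] /= sKL]|s0] := pselect (exists q : cell M * cell M, interface s q.1 q.2); last first.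
  rewrite (_ : sides s = None).
    rewrite big1 ?mulr0// => q _; case: asboolP => // -[_ sq].
    by case: s0; exists q.
  case E : (sides s) => [q|//]; case: s0; exists q; exact: sidesP.
have [[K0 L0] -> KLE] := interface_sides adm sKL.
have sKL0 : interface s K0 L0 by case: KLE => -[-> ->] //; exact: interfaceC.
have K0L0 : K0 != L0 by case: sKL0.
rewrite (bigD1 (K0, L0))//= (bigD1 (L0, K0))/=; last first.
  by apply: contra K0L0 => /eqP[->].
rewrite big1 ?addr0 => [|[K' L'] /andP[h1 h2]]; last first.
  case: asboolP => // -[_ /(interface_unique adm sKL0)/=[[E1 E2]|[E1 E2]]].
    by move: h1; rewrite E1 E2 eqxx.
  by move: h2; rewrite E1 E2 eqxx.
have a0 := area_ge0 s.
have ja0 : 0 <= `|v K0 - v L0| * area s by rewrite mulr_ge0.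
by rewrite (distrC (v L0)); do 2 case: ifP => _; lra.
Qed.

(** (n + 1) (2 m) bounds the scalar product of a unit vector with a vector whose
    coordinates are at most 2 m, and 2^n compares the closure of a face with the
    face. *)
Let sweep_factor : R := n.+1%:R * (2 * m) * 2 ^+ n.

Lemma sweep_factor_ge0 : 0 <= sweep_factor.
Proof. by rewrite /sweep_factor mulr_ge0 ?exprn_ge0// !mulr_ge0// ltW. Qed.

(** Either the common boundary of K and L has zero surface, or it is the closure
    of a face.  If that face is in the boundary of Omega, the segment avoids it,
    since D is convex and inside Omega; otherwise its area is part of
    [contact]. *)
Lemma sweep_contact K L (D : set 'rV[R]_n.+1) (h : 'rV[R]_n.+1) :
  K != L -> @convex_set R 'rV[R]_n.+1 D ->
  D `<=` Omega -> (forall i, `|h 0 i| <= 2 * m) ->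
  (lebesgue [set x | (D x /\ D (x + h)%R) /\ exists t : R, (0 <= t <= 1)%R /\
     (closure (volume K) `&` closure (volume L)) (x + t *: h)%R] <=
   (sweep_factor * contact K L)%:E)%E.
Proof.
move=> KL cD DO hm; set F := closure _ `&` _.
have m2 : 0 < 2 * m by move: m_gt0; lra.
have cF : closed F by apply: closedI; exact: closed_closure.
have sub : [set x | (D x /\ D (x + h)) /\ exists t : R, 0 <= t <= 1 /\ F (x + t *: h)]
    `<=` [set x | exists t : R, 0 <= t <= 1 /\ F (x + t *: h)] by move=> x [].
have c0 : 0 <= sweep_factor * contact K L by rewrite mulr_ge0 ?sweep_factor_ge0 ?contact_ge0.
have [F0|[s sF]] := volume_intersection adm KL.
  apply: (le_trans (le_lebesgue sub)).
  apply: (le_trans (lebesgue_sweep_surface m2 hm cF)).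
  by rewrite F0 mule0 lee_fin.
have sKL : interface s K L by split.
have [s_int|s_ext] := pselect (interior_edge Omega s); last first.
  rewrite (_ : [set x | _] = set0) ?lebesgue0 ?lee_fin// -subset0.
  move=> x [[Dx Dxh] [t [/andP[t0 t1]]]]; rewrite /F sF => Ft.
  have Ot : Omega (x + t *: h).
    apply: DO; have := convex_setP cD Dxh Dx t0 t1.
    by congr D; apply/rowP => i; rewrite !mxE; ring.
  have nO : nbhs (x + t *: h) Omega by exact: open_nbhs_nbhs.
  have [y [sy Oy]] := Ft _ nO.
  have /contrapT/(_ y sy)[_] := s_ext; apply.
  by rewrite (interior_id _).1.
apply: (le_trans (le_lebesgue sub)).
apply: (le_trans (lebesgue_sweep_surface m2 hm cF)); rewrite /F sF.
have kk : (0 <= (n.+1%:R * (2 * m))%:E)%E by rewrite lee_fin mulr_ge0// ltW.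
apply: (le_trans (lee_wpmul2l kk (surface_closure_face adm bounded s))).
rewrite -EFinM lee_fin [leLHS]mulrA -/sweep_factor ler_wpM2l ?sweep_factor_ge0//.
rewrite /contact (bigD1 s)/=; last by apply/asboolP.
by rewrite lerDl; apply: sumr_ge0 => s' _; exact: area_ge0.
Qed.

(** The traces on the segment of the closures of the cells form a closed
    cover of [0, 1], because D is convex and inside Omega. *)
Lemma segment_jumps v (D : set 'rV[R]_n.+1) K L (x h : 'rV[R]_n.+1) :
  @convex_set R 'rV[R]_n.+1 D ->
  D `<=` Omega -> D x -> D (x + h) -> volume K x -> volume L (x + h) ->
  `|v K - v L| <= \sum_(q : cell M * cell M | `[< exists t : R, 0 <= t <= 1 /\
    (closure (volume q.1) `&` closure (volume q.2)) (x + t *: h) >])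
    `|v q.1 - v q.2|.
Proof.
move=> cD DO Dx Dxh Kx Lxh.
pose C J := [set t : R | closure (volume (m := M) J) (x + t *: h)].
apply: (@closed_cover_jumps R (cell M) v C).
- move=> J; apply: (@preimage_closed _ _ (fun t : R => x + t *: h)).
    by move=> t _; exact: affine_continuous.
  exact: closed_closure.
- move=> t /andP[t0 t1].
  have : closure Omega (x + t *: h).
    apply: subset_closure; apply: DO; have := convex_setP cD Dxh Dx t0 t1.
    by congr D; apply/rowP => i; rewrite !mxE; ring.
  by rewrite (closure_cover adm) => -[J _ Jt]; exists J.
- by rewrite /C /= scale0r addr0; exact: subset_closure.
- by rewrite /C /= scale1r; exact: subset_closure.
Qed.

Notation tup := (n.+1.-tuple (measurableTypeR R)).

(** Integrate [segment_jumps] over the pairs (x, h).  Sliced at fixed x, the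
    left-hand side becomes a sum of products of volumes; sliced at fixed h, the
    right-hand side is bounded by [sweep_contact], and only the h of a bounded
    box contribute. *)
Lemma convex_jumps v (D : set 'rV[R]_n.+1) : open D ->
  @convex_set R 'rV[R]_n.+1 D -> D `<=` Omega ->
  \sum_(q : cell M * cell M)
    `|v q.1 - v q.2| * (vol (volume q.1 `&` D) * vol (volume q.2 `&` D)) <=
  (2 * (2 * m + 1)) ^+ n.+1 * sweep_factor * (2 * jumps v).
Proof.
move=> oD cD DO; pose mu := (lebesgue_tuple R n.+1 \x lebesgue_tuple R n.+1)%E.
have oKD K : open (volume K `&` D) by apply: openI => //; exact: (volume_open adm).
(* A: x in the first cell, x + h in the second; B: the segment from x to x + h
   meets the common boundary of the two cells. *)
pose A (q : cell M * cell M) : set (tup * tup) := [set z |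
  (volume q.1 `&` D) (row_of z.1) /\ (volume q.2 `&` D) (row_of z.1 + row_of z.2)].
pose B (q : cell M * cell M) : set (tup * tup) := [set z |
  (D (row_of z.1) /\ D (row_of z.1 + row_of z.2)) /\
  exists t : R, 0 <= t <= 1 /\ (closure (volume q.1) `&` closure (volume q.2))
     (row_of z.1 + t *: row_of z.2)].
have mA q : measurable (A q).
  apply: measurableI; first exact: (measurable_fst_in (borel_open (oKD _))).
  exact: (measurable_sum_in (borel_open (oKD _))).
have mB q : measurable (B q).
  apply: measurableI.
    apply: measurableI; first exact: (measurable_fst_in (borel_open oD)).
    exact: (measurable_sum_in (borel_open oD)).
  by apply: measurable_segment_hits; apply: closedI; exact: closed_closure.
pose c (q : cell M * cell M) : R := `|v q.1 - v q.2|.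
have c_ge0 q : 0 <= c q by exact: normr_ge0.
have AB z : \sum_q c q * \1_(A q) z <= \sum_q c q * \1_(B q) z.
  have rhs0 : 0 <= \sum_q c q * \1_(B q) z by apply: sumr_ge0 => q _; rewrite mulr_ge0.
  have [[q Aqz]|nA] := pselect (exists q, A q z); last first.
    by rewrite big1// => q _; rewrite indicE memNset ?mulr0// => ?; apply: nA; exists q.
  rewrite (bigD1 q)//= big1 => [|q' q'q]; last first.
    rewrite indicE memNset ?mulr0// => -[[K1 _] [K2 _]].
    case: Aqz => -[q1 _] [q2 _]; move: q'q.
    rewrite (surjective_pairing q') (surjective_pairing q).
    by rewrite (volume_disj adm K1 q1) (volume_disj adm K2 q2) eqxx.
  rewrite addr0 indicE mem_set// mulr1.
  case: (Aqz) => -[q1 D1] [q2 D2].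
  apply: (le_trans (segment_jumps v cD DO D1 D2 q1 q2)).
  rewrite big_mkcond; apply: ler_sum => q' _; case: asboolP => [h|_].
    by rewrite indicE mem_set ?mulr1//.
  by rewrite mulr_ge0.
have := @sum_measure_le R _ _ mu _ _ c c A B c_ge0 c_ge0 mA mB AB.
pose H := ball (0 : 'rV[R]_n.+1) (2 * m + 1).
have H1 : lebesgue H = ((2 * (2 * m + 1)) ^+ n.+1)%:E.
  by rewrite lebesgue_ball//; move: m_gt0; lra.
have KDm K : in_box m (volume K `&` D).
  by apply: in_boxS (volume_in_box adm (K := K) box); exact: subIsetl.
have muA q : (mu (A q) = (vol (volume q.1 `&` D) * vol (volume q.2 `&` D))%:E)%E.
  rewrite /mu /A pair_measure; [|exact: borel_open|exact: borel_open].
  by rewrite !(volE (KDm _)) -EFinM mulrC.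
have muB q : ((c q)%:E * mu (B q) <=
    (c q * (contact q.1 q.2 * (sweep_factor * (2 * (2 * m + 1)) ^+ n.+1)))%:E)%E.
  have [qq|qq] := eqVneq q.1 q.2.
    by rewrite /c qq subrr normr0 mul0e mul0r.
  have kc0 : (0 <= (sweep_factor * contact q.1 q.2)%:E)%E.
    by rewrite lee_fin; apply: mulr_ge0; [exact: sweep_factor_ge0|exact: contact_ge0].
  rewrite EFinM lee_wpmul2l ?lee_fin//.
  rewrite mulrA (mulrC (contact _ _)) EFinM -H1 lebesgueE; last exact: borel_ball.
  apply: product_measure_le_ysections => //.
  - exact: borel_ball.
  move=> y; set h := row_of y.
  have hB : ysection (B q) y = (@row_of R n.+1) @^-1` [set x |
      (D x /\ D (x + h)) /\ exists t : R, 0 <= t <= 1 /\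
     (closure (volume q.1) `&` closure (volume q.2)) (x + t *: h)].
    by apply/seteqP; rewrite /ysection; split=> t /=; rewrite inE.
  (* A direction h with a larger coordinate cannot join two points of Omega. *)
  have [hm|hm] := pselect (forall i, `|h 0 i| <= 2 * m); last first.
    rewrite hB (_ : _ @^-1` _ = set0).
      by rewrite measure0; apply: mule_ge0 => //; rewrite lee_fin.
    rewrite -subset0 => t /= [[Dx Dxh] _]; apply: hm => i.
    have DO' : D `<=` closure Omega by move=> x /DO; exact: subset_closure.
    have := box (DO' _ Dx) i; have := box (DO' _ Dxh) i.
    rewrite [X in `|X| <= _ -> _]mxE !ler_norml.
    by move: (row_of t 0 i) (h 0 i) => a b; lra.
  rewrite indicE mem_set ?mule1; last first.
    have r0 : 0 < 2 * m + 1 by move: m_gt0; lra.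
    apply/(ball_rowP _ _ r0) => i; rewrite mxE sub0r normrN.
    by rewrite (le_lt_trans (hm i))//; lra.
  apply: le_trans (sweep_contact qq cD DO hm).
  rewrite hB -lebesgueE// /borel -hB; exact: measurable_ysection.
move=> /le_trans/(_ (lee_sum _ (fun q _ => muB q))).
rewrite [X in (X <= _)%E -> _](_ : _ = (\sum_(q : cell M * cell M)
    c q * (vol (volume q.1 `&` D) * vol (volume q.2 `&` D)))%:E); last first.
  rewrite -sumEFin; apply: eq_bigr => q _; rewrite EFinM.
  by congr (_ * _)%E; exact: muA.
rewrite sumEFin lee_fin => /le_trans; apply.
under eq_bigr do rewrite mulrA.
rewrite -big_distrl /= mulrC (mulrC _ sweep_factor) ler_wpM2l ?sum_contact//.
by rewrite mulr_ge0 ?sweep_factor_ge0// exprn_ge0//; move: m_gt0; lra.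
Qed.

End convex_pieces.

(** * From convex pieces to the whole domain *)

Lemma set_empty_or T (A : set T) : A = set0 \/ A !=set0.
Proof. by have [->|/set0P] := eqVneq A set0; [left|right]. Qed.

Section null_sets.
Context (R : realType).

Lemma vol_cover n m (E : finType) (F : E -> set 'rV[R]_n) (A N : set 'rV[R]_n) :
  in_box m A -> (forall e, in_box m (F e)) -> lebesgue N = 0%E ->
  (forall x, A x -> N x \/ exists e, F e x) -> vol A <= \sum_e vol (F e).
Proof.
move=> Am Fm N0 AF; rewrite -lee_fin -(volE Am) -sumEFin.
under eq_bigr do rewrite -(volE (Fm _)).
have AU : A `<=` N `|` [set x | exists2 e, e \in index_enum E & F e x].
  by move=> x /AF[Nx|[e Fx]]; [left|right; exists e => //; rewrite mem_index_enum].
apply: (le_trans (le_lebesgue AU)); apply: (le_trans (lebesgue_subadditive _ _)).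
by rewrite N0 add0e; apply: lebesgue_bigcup.
Qed.

Lemma lebesgue_hyperplanes n (hs : seq ('rV[R]_n.+1 * R)) :
  (forall h, h \in hs -> h.1 != 0) ->
  lebesgue [set x | exists2 h, h \in hs & hyperplane h.1 h.2 x] = 0%E.
Proof.
move=> hs0; apply/eqP; rewrite eq_le lebesgue_ge0 andbT.
apply: (@le_trans _ _ (\sum_(h <- hs) lebesgue (hyperplane h.1 h.2))%E).
  exact: lebesgue_bigcup.
by rewrite big_seq big1// => h /hs0; exact: lebesgue_hyperplane.
Qed.

Lemma lebesgue_boundary n (A : set 'rV[R]_n.+1) : polyhedral A ->
  lebesgue (boundary A) = 0%E.
Proof.
move=> [hs [hs0 Ahs]]; apply/eqP; rewrite eq_le lebesgue_ge0 andbT.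
by rewrite -(lebesgue_hyperplanes hs0); exact: le_lebesgue.
Qed.

End null_sets.

Section linked.
Context (R : realType) (n : nat) (Omega : set 'rV[R]_n.+1).
Hypotheses (Omega_open : open Omega) (Omega_bounded : bounded_set Omega).
Implicit Types (A B D : set 'rV[R]_n.+1).

(** The integral of |v(x) - v(y)| over A x B. *)
Definition oscillation (M : mesh R n.+1) (v : cell M -> R) A B : R :=
  \sum_(q : cell M * cell M)
    `|v q.1 - v q.2| * (vol (volume q.1 `&` A) * vol (volume q.2 `&` B)).

Lemma oscillationE (M : mesh R n.+1) (v : cell M -> R) A B :
  oscillation v A B = \sum_(K : cell M) \sum_(L : cell M)
    `|v K - v L| * (vol (volume K `&` A) * vol (volume L `&` B)).
Proof.
rewrite /oscillation (pair_bigA _ (fun K L : cell M =>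
  `|v K - v L| * (vol (volume K `&` A) * vol (volume L `&` B)))).
by apply: eq_bigr => -[].
Qed.

(** C is chosen before the mesh: this is what makes the final constant depend
    on the domain only. *)
Definition linked A B := exists2 C : R, 0 <= C &
  forall M : mesh R n.+1, admissible Omega M -> forall v : cell M -> R,
    oscillation v A B <= C * jumps Omega v.

Lemma jumps_ge0 (M : mesh R n.+1) (v : cell M -> R) : 0 <= jumps Omega v.
Proof.
apply: sumr_ge0 => s _; case: sides => [KL|//].
by rewrite mulr_ge0// area_ge0.
Qed.

Lemma linked_sub A A' B B' : A' `<=` A -> B' `<=` B -> A `<=` Omega ->
  B `<=` Omega -> linked A B -> linked A' B'.
Proof.
move=> AA BB AO BO [C C0 AC]; exists C => // M adm v.
apply: le_trans (AC M adm v); have [m m0 Om] := bounded_in_box Omega_bounded.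
have mono K X Y : X `<=` Y -> Y `<=` Omega ->
    vol (volume (m := M) K `&` X) <= vol (volume K `&` Y).
  move=> XY YO; apply: (@le_vol _ _ m); first exact: setIS.
  by apply: in_boxS Om => x [_ /YO].
apply: ler_sum => q _; rewrite ler_wpM2l// ler_pM ?vol_ge0//; exact: mono.
Qed.

Lemma linked_sym A B : linked A B -> linked B A.
Proof.
move=> [C C0 AC]; exists C => // M adm v; apply: le_trans (AC M adm v).
rewrite !oscillationE exchange_big /= le_eqVlt; apply/orP; left; apply/eqP.
by apply: eq_bigr => K _; apply: eq_bigr => L _; rewrite distrC (mulrC (vol _)).
Qed.

(** This is [convex_jumps]; n and the size of a box around Omega determine C. *)
Lemma linked_convex D : open D -> @convex_set R 'rV[R]_n.+1 D ->
  D `<=` Omega -> linked D D.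
Proof.
move=> oD cD DO.
have [m m0 Om] : exists2 m : R, 0 < m & in_box m (closure Omega).
  exact: closure_in_box.
exists ((2 * (2 * m + 1)) ^+ n.+1 * (n.+1%:R * (2 * m) * 2 ^+ n) * 2).
  have m0' := ltW m0.
  by rewrite !mulr_ge0 ?exprn_ge0 ?mulr_ge0 ?addr_ge0 ?mulr_ge0.
move=> M adm v; rewrite -mulrA.
exact: (convex_jumps adm Omega_bounded Omega_open m0 Om).
Qed.

(** The cells cover Omega up to their boundaries, which are null. *)
Lemma vol_mesh (M : mesh R n.+1) A : admissible Omega M -> A `<=` Omega ->
  vol A <= \sum_(K : cell M) vol (volume K `&` A).
Proof.
move=> adm AO; have [m m0 Om] := bounded_in_box Omega_bounded.
pose N := [set x | exists2 K : cell M, K \in index_enum (cell M) & boundary (volume K) x].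
apply: (@vol_cover _ _ m _ _ _ N).
- exact: in_boxS Om.
- by move=> K; apply: in_boxS Om => x [_ /AO].
- apply/eqP; rewrite eq_le lebesgue_ge0 andbT.
  apply: (@le_trans _ _ (\sum_(K : cell M) lebesgue (boundary (volume K)))%E).
    exact: lebesgue_bigcup.
  by rewrite big1// => K _; apply: lebesgue_boundary; exact: (volume_polyhedral adm).
move=> x Ax; have : closure Omega x by apply: subset_closure; exact: AO.
rewrite (closure_cover adm) => -[K _ Kx].
have [Kx'|nKx] := pselect (volume K x); first by right; exists K.
left; exists K; first by rewrite mem_index_enum.
by split => //; rewrite (interior_id _).1//; exact: (volume_open adm).
Qed.

Lemma sum_vol_mesh (M : mesh R n.+1) A (P : pred (cell M)) :
  admissible Omega M -> open A -> A `<=` Omega ->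
  \sum_(K | P K) vol (volume K `&` A) <= vol A.
Proof.
move=> adm oA AO; have [m m0 Om] := bounded_in_box Omega_bounded.
have Am : in_box m A by exact: in_boxS Om.
pose F K := if P K then volume K `&` A else set0.
have oF K : open (F K).
  rewrite /F; case: ifP => _; last exact: open0.
  by apply: openI => //; exact: (volume_open adm).
have FA K : F K `<=` A by rewrite /F; case: ifP => _ x; [case|].
have := @sum_vol_le R n.+1 m (cell M) 'I_1 (fun=> 1) (fun=> 1) F (fun=> A).
rewrite big_ord1 mul1r => h; apply: (le_trans _ (h _ _ _ _ _ _ _)) => //.
- rewrite big_mkcond; apply: ler_sum => K _; rewrite /F mul1r.
  by case: ifP => // _; exact: vol_ge0.
- by move=> K; exact: in_boxS Am.
- by move=> K; exact: borel_open.
- by move=> _; exact: borel_open.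
move=> x; rewrite big_ord1 mul1r.
have [[K FKx]|nx] := pselect (exists K, F K x).
  rewrite (bigD1 K)//= big1 => [|K' KK'].
    by rewrite addr0 mul1r !indicE !mem_set//; exact: FA FKx.
  rewrite mul1r indicE memNset// => FK'x; move/eqP: KK'; apply.
  move: FKx FK'x; rewrite /F; case: ifP => // _ [Kx _]; case: ifP => // _ [K'x _].
  exact: (volume_disj adm K'x Kx).
rewrite big1 ?indicE// => K _; rewrite mul1r indicE memNset//.
by move=> FKx; apply: nx; exists K.
Qed.

(** Average |v(x) - v(y)| <= |v(x) - v(z)| + |v(z) - v(y)| over z in B. *)
Lemma linked_trans A B (E : set 'rV[R]_n.+1) : open A -> open B -> open E -> B !=set0 ->
  A `<=` Omega -> B `<=` Omega -> E `<=` Omega ->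
  linked A B -> linked B E -> linked A E.
Proof.
move=> oA oB oE B0 AO BO EO [C C0 hC] [C' C'0 hC'].
have [m m0 Om] := bounded_in_box Omega_bounded.
have vB : 0 < vol B by apply: (vol_gt0 (M := m)) => //; exact: in_boxS Om.
exists ((C * vol E + C' * vol A) / vol B).
  apply: divr_ge0; last exact: ltW.
  by rewrite addr_ge0// mulr_ge0// vol_ge0.
move=> M adm v; rewrite mulrAC ler_pdivlMr//.
pose a K := vol (volume (m := M) K `&` A).
pose b K := vol (volume (m := M) K `&` B).
pose e K := vol (volume (m := M) K `&` E).
have a0 K : 0 <= a K := vol_ge0 _.
have b0 K : 0 <= b K := vol_ge0 _.
have e0 K : 0 <= e K := vol_ge0 _.
have sa : \sum_K a K <= vol A by exact: sum_vol_mesh.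
have se : \sum_K e K <= vol E by exact: sum_vol_mesh.
have sb : vol B <= \sum_K b K by exact: vol_mesh.
have := hC M adm v; have := hC' M adm v; rewrite !oscillationE.
set S := jumps _ _ => BE AB.
apply: (@le_trans _ _ (\sum_K \sum_L \sum_J
    (`|v K - v J| * (a K * b J) * e L + `|v J - v L| * (b J * e L) * a K))).
  rewrite big_distrl /=; apply: ler_sum => K _.
  rewrite big_distrl /=; apply: ler_sum => L _.
  apply: (@le_trans _ _ (`|v K - v L| * (a K * e L) * \sum_J b J)).
    by rewrite ler_wpM2l// !mulr_ge0 ?vol_ge0.
  rewrite big_distrr /=; apply: ler_sum => J _.
  have -> : `|v K - v J| * (a K * b J) * e L + `|v J - v L| * (b J * e L) * a K =
     (`|v K - v J| + `|v J - v L|) * (a K * e L * b J) by ring.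
  rewrite -mulrA ler_wpM2r ?mulr_ge0//.
  by rewrite (le_trans _ (ler_normD _ _))// addrA subrK.
(* Each of the two terms is independent of one of the three cells. *)
have -> : \sum_K \sum_L \sum_J
    (`|v K - v J| * (a K * b J) * e L + `|v J - v L| * (b J * e L) * a K) =
    (\sum_K \sum_J `|v K - v J| * (a K * b J)) * (\sum_L e L) +
    (\sum_J \sum_L `|v J - v L| * (b J * e L)) * (\sum_K a K).
  under eq_bigr do under eq_bigr do rewrite big_split.
  under eq_bigr do rewrite big_split /=.
  rewrite big_split /=; congr (_ + _).
    rewrite big_distrl; apply: eq_bigr => K _; rewrite exchange_big /=.
    rewrite big_distrl; apply: eq_bigr => J _.
    by rewrite big_distrr.
  rewrite big_distrr; apply: eq_bigr => K _ /=.
  rewrite exchange_big big_distrl /=; apply: eq_bigr => J _.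
  by rewrite big_distrl.
rewrite mulrDl lerD//.
  rewrite mulrAC ler_pM//.
  - by apply: sumr_ge0 => K _; apply: sumr_ge0 => L _; rewrite !mulr_ge0.
  - by apply: sumr_ge0.
rewrite mulrAC ler_pM//.
- by apply: sumr_ge0 => K _; apply: sumr_ge0 => L _; rewrite !mulr_ge0.
- by apply: sumr_ge0.
Qed.

Lemma ball_sub_open (U : set 'rV[R]_n.+1) x : open U -> U x ->
  exists2 r : R, 0 < r & ball x r `<=` U.
Proof. by move=> oU Ux; apply/nbhs_ballP; exact: open_nbhs_nbhs. Qed.

Lemma linked_in_convex D A B : open D -> @convex_set R 'rV[R]_n.+1 D ->
  D `<=` Omega -> A `<=` D -> B `<=` D -> linked A B.
Proof. by move=> oD cD DO AD BD; exact: linked_sub (linked_convex oD cD DO). Qed.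

Hypothesis Omega_connected : connected Omega.

(** The points y of Omega that have a ball linked to the given one form a subset
    that is open, and closed in Omega: a ball around a limit point, being
    convex, is linked to its intersection with a ball around a point of the
    subset. *)
Lemma linked_balls x0 r0 x : 0 < r0 -> ball x0 r0 `<=` Omega -> Omega x ->
  exists2 r : R, 0 < r & ball x r `<=` Omega /\ linked (ball x r) (ball x0 r0).
Proof.
move=> r00 B0 Ox; have Ox0 : Omega x0 by apply: B0; exact: ballxx.
pose U := [set y | exists2 r : R, 0 < r &
  ball y r `<=` Omega /\ linked (ball y r) (ball x0 r0)].
have UO : U `<=` Omega by move=> y [r r_gt0 [yO _]]; apply: yO; exact: ballxx.
have oU : open U.
  rewrite openE => y [r r_gt0 [yO yl]]; apply/nbhs_ballP; exists r => // z yz.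
  have [s s0 zs] := ball_sub_open (@open_ball_row R _ y r) yz.
  exists s => //; split; first exact: subset_trans zs yO.
  exact: linked_sub zs _ yO B0 yl.
suff UE : U = Omega by have : U x by rewrite UE.
apply: Omega_connected.
- by exists x0, r0 => //; split => //; apply: linked_in_convex B0 _ _ => //;
    [exact: open_ball_row|exact: convex_ball].
- by exists U => //; apply/seteqP; split=> y; [move=> Uy; split => //; exact: UO|case].
exists (closure U); first exact: closed_closure.
apply/seteqP; split=> y; first by move=> Uy; split; [exact: UO|exact: subset_closure].
move=> [Oy Uy]; have [r r_gt0 yr] := ball_sub_open Omega_open Oy.
have [z [[s s0 [zO zl]] yz]] := Uy _ (nbhsx_ballx y r r_gt0).
exists r => //; split => //.
apply: (@linked_trans _ (ball y r `&` ball z s)) => //.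
- exact: open_ball_row.
- by apply: openI; exact: open_ball_row.
- exact: open_ball_row.
- by exists z; split => //; exact: ballxx.
- by move=> w [/yr].
- by apply: (@linked_in_convex (ball y r)) => //;
    [exact: open_ball_row|exact: convex_ball].
- by apply: linked_sub zl => //; exact: subIsetr.
Qed.

(** Go from D to a small ball in D, then to a ball around a point of D', then
    to the intersection of this ball with D', and finally to D'. *)
Lemma linked_convex_all D D' : open D -> @convex_set R 'rV[R]_n.+1 D ->
  D `<=` Omega -> open D' -> @convex_set R 'rV[R]_n.+1 D' -> D' `<=` Omega ->
  linked D D'.
Proof.
move=> oD cD DO oD' cD' DO'.
have linked0 A B : (A = set0 \/ B = set0) -> linked A B.
  move=> AB; exists 0 => // M adm v; rewrite mul0r /oscillation big1// => q _.
  have v0 X : vol (X `&` set0 : set 'rV[R]_n.+1) = 0.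
    by rewrite setI0 /vol lebesgue0.
  by case: AB => ->; rewrite v0 ?(mulr0, mul0r).
have [D0|[x0 Dx0]] := set_empty_or D; first by apply: linked0; left.
have [D'0|[y0 D'y0]] := set_empty_or D'; first by apply: linked0; right.
have [r0 r00 xD] := ball_sub_open oD Dx0.
have [r r_gt0 [yO yl]] := linked_balls r00 (subset_trans xD DO) (DO' _ D'y0).
pose W := ball y0 r `&` D'.
have oW : open W by apply: openI => //; exact: open_ball_row.
apply: (@linked_trans _ (ball x0 r0)) => //.
- exact: open_ball_row.
- by exists x0; exact: ballxx.
- exact: subset_trans xD DO.
- exact: linked_in_convex oD cD DO _ _.
apply: linked_sym; apply: (@linked_trans _ W) => //.
- exact: open_ball_row.
- by exists y0; split => //; exact: ballxx.
- by move=> w [/yO].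
- exact: subset_trans xD DO.
- by apply: (linked_in_convex oD' cD' DO') => //; exact: subIsetr.
- by apply: linked_sub yl => //; [exact: subIsetl|exact: subset_trans xD DO].
Qed.

(** Expand the double integral over the pieces; finitely many constants add
    up. *)
Lemma linked_cover (E : finType) (F : E -> set 'rV[R]_n.+1) (N : set 'rV[R]_n.+1) :
  (forall e, F e `<=` Omega) -> lebesgue N = 0%E ->
  (forall x, Omega x -> N x \/ exists e, F e x) ->
  (forall e e', linked (F e) (F e')) -> linked Omega Omega.
Proof.
move=> FO N0 cov FF.
have /choice[C hC] : forall q : E * E, exists C : R, 0 <= C /\
    forall M : mesh R n.+1, admissible Omega M -> forall v : cell M -> R,
    oscillation v (F q.1) (F q.2) <= C * jumps Omega v.
  by move=> q; have [C C0 h] := FF q.1 q.2; exists C.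
exists (\sum_q C q); first by apply: sumr_ge0 => q _; have [] := hC q.
move=> M adm v; have [m m0 Om] := bounded_in_box Omega_bounded.
rewrite big_distrl /=.
apply: (@le_trans _ _ (\sum_q oscillation v (F q.1) (F q.2))); last first.
  by apply: ler_sum => q _; have [_] := hC q; exact.
have volF K : vol (volume (m := M) K `&` Omega) <= \sum_e vol (volume K `&` F e).
  apply: (@vol_cover _ _ m _ _ _ N) => //.
  - by apply: in_boxS Om => x [].
  - by move=> e; apply: in_boxS Om => x [_ /FO].
  by move=> x [Kx /cov[Nx|[e Fx]]]; [left|right; exists e].
rewrite /oscillation exchange_big /=; apply: ler_sum => q _.
rewrite -big_distrr /= ler_wpM2l//.
apply: (@le_trans _ _ ((\sum_e vol (volume q.1 `&` F e)) *
    (\sum_e vol (volume q.2 `&` F e)))).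
  by rewrite ler_pM ?vol_ge0.
rewrite big_distrlr /= pair_bigA.
by rewrite le_eqVlt; apply/orP; left; apply/eqP/eq_bigr => -[].
Qed.

(** A segment of D cannot leave Omega without meeting its boundary. *)
Lemma convex_in_or_out D : @convex_set R 'rV[R]_n.+1 D ->
  (forall x, D x -> ~ boundary Omega x) -> D `&` Omega !=set0 -> D `<=` Omega.
Proof.
move=> cD nb [x [Dx Ox]] y Dy.
pose p (t : R) := x + t *: (y - x).
have Dp t : `[0, 1]%classic t -> D (p t).
  rewrite /= in_itv/= => /andP[t0 t1].
  have := convex_setP cD Dy Dx t0 t1.
  by congr D; apply/rowP => i; rewrite !mxE; ring.
have cp : continuous p by exact: affine_continuous.
pose B := `[0, 1]%classic `&` p @^-1` Omega.
have BE : B = `[0, 1]%classic.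
  apply: (@segment_connected R 0 1).
  - exists 0; split; first by rewrite /= in_itv/= lexx ler01.
    by rewrite /p /= scale0r addr0.
  - by exists (p @^-1` Omega) => //; exact: open_comp_continuous.
  exists (p @^-1` closure Omega).
    apply: preimage_closed; first by move=> t _; exact: cp.
    exact: closed_closure.
  apply/seteqP; split=> t [t01 pt]; split => //; first exact: subset_closure.
  apply: contrapT => nO; apply: (nb _ (Dp _ t01)); split => //.
  by rewrite (interior_id _).1.
have [_] : B 1 by rewrite BE /= in_itv/= lexx ler01.
by rewrite /p /= scale1r addrC subrK.
Qed.

Hypothesis Omega_polyhedral : polyhedral Omega.

(** The hyperplanes that carry the boundary of Omega cut the space into open
    convex polyhedra, one for each choice of a side of every hyperplane.  None
    of them meets the boundary of Omega, so each is either inside Omega or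
    disjoint from it. *)
Lemma linked_domain : linked Omega Omega.
Proof.
have [hs [hs0 bhs]] := Omega_polyhedral.
pose k := size hs; pose h (i : 'I_k) := nth (0, 0) hs i.
have hin (i : 'I_k) : h i \in hs by apply: mem_nth.
(* The sign vector e selects for each hyperplane one of its open sides, written
   as dot (w e i) x < c e i. *)
pose w (e : {ffun 'I_k -> bool}) i := if e i then (h i).1 else - (h i).1.
pose c (e : {ffun 'I_k -> bool}) i := if e i then (h i).2 else - (h i).2.
pose D e := \bigcap_(i in [set: 'I_k]) [set x | dot (w e i) x < c e i].
have oD e : open (D e).
  rewrite -[D e]setCK /D setC_bigcap; apply: closed_openC.
  apply: closed_bigcup => [|i _]; first exact: finite_finset.
  by apply: open_closedC; exact: open_halfspace.
have cD e : @convex_set R 'rV[R]_n.+1 (D e).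
  move=> x y t; rewrite !inE => Dx Dy i _.
  by apply/set_mem; apply: convex_halfspace; apply/mem_set; [exact: Dx|exact: Dy].
have Dnb e x : D e x -> ~ boundary Omega x.
  move=> Dx /bhs[g ghs gx].
  have ik : (index g hs < k)%N by rewrite index_mem.
  have := Dx (Ordinal ik) I; rewrite /w /c /h /= nth_index//.
  by case: ifP => _; rewrite ?dotNl gx ltxx.
pose F e := D e `&` Omega.
have FE e : F e = set0 \/ F e = D e.
  have [->|[x Fx]] := set_empty_or (F e); [by left|right].
  apply/seteqP; split; first exact: subIsetl.
  move=> y Dy; split => //.
  by apply: (convex_in_or_out (cD e) (@Dnb e)) Dy; exists x.
pose N := [set x | exists2 g, g \in hs & hyperplane g.1 g.2 x].
apply: (@linked_cover _ F N).
- by move=> e x [].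
- exact: lebesgue_hyperplanes.
- move=> x Ox; have [Nx|nN] := pselect (N x); [by left|right].
  exists [ffun i => dot (h i).1 x < (h i).2]; split => // i _ /=.
  rewrite /w /c ffunE; case: ifPn => //; rewrite -leNgt le_eqVlt => /predU1P[E|lt].
    by case: nN; exists (h i).
  by rewrite dotNl ltrN2.
move=> e e'; have FO e1 : F e1 `<=` Omega by move=> x [].
have oF e1 : open (F e1) by exact: openI.
apply: linked_convex_all => //.
  by case: (FE e) => ->; [move=> x y t; rewrite inE|exact: cD].
by case: (FE e') => ->; [move=> x y t; rewrite inE|exact: cD].
Qed.

End linked.

(** * Medians and signed powers *)

Section median.
Context (R : realType).

(** Replacing 0 by a moves the value |a| further away on at least half of the
    mass, and at most |a| closer on the rest. *)
Lemma median_minimizes (T : finType) (m v : T -> R) (W a : R) :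
  (forall K, 0 <= m K) -> \sum_K m K = W ->
  \sum_(K | 0 < v K) m K <= W / 2 -> \sum_(K | v K < 0) m K <= W / 2 ->
  \sum_K m K * `|v K| <= \sum_K m K * `|v K - a|.
Proof.
move=> m0 mW pos neg.
(* |v - a| >= |v| + |a| off the cells of P, which lie on the side of a, and
   |v - a| >= |v| - |a| on them. *)
pose b : R := if 0 <= a then a else - a.
pose P K := if 0 <= a then 0 < v K else v K < 0.
have b0 : 0 <= b by rewrite /b; case: ifPn => //; rewrite -ltNge; lra.
have Pm : \sum_(K | P K) m K <= W / 2 by rewrite /P; case: (0 <= a).
apply: (@le_trans _ _ (\sum_K (m K * `|v K| + b * m K - 2 * b * (if P K then m K else 0)))).
  rewrite !big_split /= sumrN -!big_distrr /= mW -big_mkcond /= -addrA lerDl.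
  by rewrite subr_ge0; nra.
apply: ler_sum => K _; have := m0 K; move: (m K) => k k0.
have -> : k * `|v K| + b * k - 2 * b * (if P K then k else 0) =
    k * (`|v K| + b - 2 * b * (if P K then 1 else 0)).
  by case: ifP => _; ring.
rewrite ler_wpM2l// /b /P; case: (ifPn (0 <= a)) => a0.
  case: ifPn => vK.
    rewrite (gtr0_norm vK); have := ler_norm (v K - a); lra.
  rewrite -leNgt in vK; rewrite ler0_norm//.
  by rewrite ler0_norm; lra.
rewrite -ltNge in a0; case: ifPn => vK.
  rewrite (ltr0_norm vK); have := ler_norm (- (v K - a)); rewrite normrN; lra.
rewrite -leNgt in vK; rewrite ger0_norm//.
by rewrite ger0_norm; lra.
Qed.

End median.

Section powers.
Context (R : realType).
Implicit Types (a b p x y : R).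

(** Young's inequality for the conjugate exponents p / (p - 1) and p, multiplied
    by p so that it also holds for p = 1. *)
Lemma young_powR p a b : 1 <= p -> 0 <= a -> 0 <= b ->
  p * (a `^ (p - 1) * b) <= (p - 1) * a `^ p + b `^ p.
Proof.
move=> p1 a0 b0; have [->|p_neq1] := eqVneq p 1.
  by rewrite subrr powRr0 mul0r add0r !mul1r powRr1.
have p_gt1 : 1 < p by rewrite lt_neqAle eq_sym p_neq1.
pose q := p / (p - 1).
have q0 : 0 < q by rewrite divr_gt0; lra.
have pq : q^-1 + p^-1 = 1 by rewrite /q; field; apply/andP; split; lra.
have := @conjugate_powR R (a `^ (p - 1)) b q p (powR_ge0 _ _) b0 q0 _ pq.
have -> : (a `^ (p - 1)) `^ q = a `^ p.
  by rewrite -powRrM /q mulrC divfK//; lra.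
move=> /(_ ltac:(lra)) h.
have -> : (p - 1) * a `^ p + b `^ p = p * (a `^ p / q + b `^ p / p).
  by rewrite /q; field; apply/andP; split; lra.
by rewrite ler_wpM2l//; lra.
Qed.

Lemma powR_subr1 p a : 1 <= p -> 0 <= a -> a `^ (p - 1) * a = a `^ p.
Proof.
by move=> p1 a0; rewrite mulrC mulr_powRB1//; lra.
Qed.

(** Apply [young_powR] to t a and b / t^(p-1), with t^p = eta. *)
Lemma young_weighted p eta a b : 1 <= p -> 0 < eta -> 0 <= a -> 0 <= b ->
  p * (a `^ (p - 1) * b) <=
  (p - 1) * eta * a `^ p + (eta `^ (p - 1))^-1 * b `^ p.
Proof.
move=> p1 eta0 a0 b0; have p0 : p != 0 by lra.
have [t t0 tp] : exists2 t : R, 0 < t & t `^ p = eta.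
  exists (eta `^ p^-1); first exact: powR_gt0.
  by rewrite -powRrM mulVf// powRr1// ltW.
pose s := t `^ (p - 1); have s0 : 0 < s by exact: powR_gt0.
have := @young_powR p (t * a) (b / s) p1 (mulr_ge0 (ltW t0) a0)
  (divr_ge0 b0 (ltW s0)).
have sV0 : 0 <= s^-1 by rewrite invr_ge0 ltW.
rewrite !(powRM _ (ltW t0) a0) (powRM _ b0 sV0) tp -/s.
have -> : s * a `^ (p - 1) * (b / s) = a `^ (p - 1) * b.
  by field; rewrite gt_eqF.
have -> : s^-1 `^ p = (eta `^ (p - 1))^-1.
  by rewrite -[s^-1]powRN -[RHS]powRN -tp -!powRrM mulrC.
by rewrite (mulrA (p - 1)) (mulrC (b `^ p)).
Qed.

(** The map x |-> sgn(x) |x|^p, increasing and odd: it preserves the sign, and so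
    preserves 0 as a median. *)
Definition signed_powR p x : R := if 0 <= x then x `^ p else - ((- x) `^ p).

Lemma norm_signed_powR p x : `|signed_powR p x| = `|x| `^ p.
Proof.
rewrite /signed_powR; case: ifPn => [x0|]; first by rewrite ger0_norm ?powR_ge0// ger0_norm.
by rewrite -ltNge => x0; rewrite normrN ger0_norm ?powR_ge0// ltr0_norm.
Qed.

Lemma signed_powR_gt0 p x : 0 < p -> 0 < signed_powR p x -> 0 < x.
Proof.
move=> p0; rewrite /signed_powR; case: ifPn => [x0|_].
  exact: gt0_powR.
by rewrite oppr_gt0 ltNge powR_ge0.
Qed.

Lemma signed_powR_lt0 p x : signed_powR p x < 0 -> x < 0.
Proof.
rewrite /signed_powR; case: ifPn => [x0|]; first by rewrite ltNge powR_ge0.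
by rewrite -ltNge.
Qed.

(** For a >= b >= 0, Young's inequality p a^(p-1) b <= (p - 1) a^p + b^p says
    that a^p - b^p <= p a^(p-1) (a - b).  For arguments of opposite signs the
    left-hand side is a^p + b^p, which is at most
    (a^(p-1) + b^(p-1)) (a + b). *)
Lemma signed_powR_dist p x y : 1 <= p ->
  `|signed_powR p x - signed_powR p y| <= p * ((`|x| `^ (p - 1) + `|y| `^ (p - 1)) * `|x - y|).
Proof.
have main a b : 1 <= p -> 0 <= b -> b <= a ->
    a `^ p - b `^ p <= p * (a `^ (p - 1) * (a - b)).
  move=> p1 b0 ba; have a0 : 0 <= a by apply: le_trans ba.
  have := young_powR p1 a0 b0; rewrite mulrBr powR_subr1//; lra.
have pos a b : 1 <= p -> 0 <= a -> 0 <= b -> `|a `^ p - b `^ p| <=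
    p * ((a `^ (p - 1) + b `^ (p - 1)) * `|a - b|).
  wlog ba : a b / b <= a.
    move=> h p1 a0 b0; have [ba|/ltW ab] := leP b a; first exact: h.
    by rewrite distrC (addrC (a `^ _)) (distrC a); exact: h.
  move=> p1 a0 b0; rewrite !ger0_norm ?subr_ge0//; last first.
    by apply: ge0_ler_powR; rewrite ?nnegrE//; lra.
  apply: (le_trans (main _ _ p1 b0 ba)); rewrite ler_wpM2l//; first lra.
  by rewrite ler_wpM2r ?subr_ge0// lerDl powR_ge0.
have opp a b : 1 <= p -> 0 <= a -> 0 <= b -> a `^ p + b `^ p <=
    p * ((a `^ (p - 1) + b `^ (p - 1)) * (a + b)).
  move=> p1 a0 b0; have := powR_ge0 a (p - 1); have := powR_ge0 b (p - 1).
  move=> B0 A0; apply: (@le_trans _ _ ((a `^ (p - 1) + b `^ (p - 1)) * (a + b))).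
    rewrite -(powR_subr1 p1 a0) -(powR_subr1 p1 b0).
    by move: (_ `^ _) (b `^ _) B0 A0 => A B B0 A0; nra.
  rewrite ler_peMl// mulr_ge0// addr_ge0//.
move=> p1; rewrite /signed_powR.
case: ifPn => x0; case: ifPn => y0.
- by rewrite !(ger0_norm x0) !(ger0_norm y0); exact: pos.
- rewrite -ltNge in y0; rewrite (ger0_norm x0) (ltr0_norm y0) opprK.
  rewrite ger0_norm ?addr_ge0 ?powR_ge0// (ger0_norm (_ : 0 <= x - y)); last lra.
  by apply: opp => //; lra.
- rewrite -ltNge in x0; rewrite (ger0_norm y0) (ltr0_norm x0) -opprD normrN.
  rewrite ger0_norm ?addr_ge0 ?powR_ge0// (ler0_norm (_ : x - y <= 0)); last lra.
  have -> : - (x - y) = - x + y by ring.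
  by apply: opp => //; lra.
rewrite -ltNge in x0; rewrite -ltNge in y0.
rewrite (ltr0_norm x0) (ltr0_norm y0) opprK addrC.
have -> : `|x - y| = `|- x - - y| by rewrite -normrN; congr `|_|; ring.
by rewrite (distrC (- x)) (addrC (_ `^ (p - 1))); apply: pos => //; lra.
Qed.

End powers.

(** * The inequality for p = 1 *)

Section poincare.
Context (R : realType) (n : nat) (Omega : set 'rV[R]_n.+1).
Hypotheses (Omega_open : open Omega) (Omega_bounded : bounded_set Omega).
Hypotheses (Omega_connected : connected Omega).
Hypothesis Omega_polyhedral : polyhedral Omega.

(** With v(y) as the constant, [median_minimizes] bounds the L1 norm of v
    by the integral of |v(x) - v(y)| in x; integrate in y and apply
    [linked_domain]. *)
Lemma poincare_median : exists2 C : R, 0 < C &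
  forall M : mesh R n.+1, admissible Omega M -> forall v : cell M -> R,
    \sum_(K | 0 < v K) vol (volume K) <= vol Omega / 2 ->
    \sum_(K | v K < 0) vol (volume K) <= vol Omega / 2 ->
    \sum_K vol (volume K) * `|v K| <= C * jumps Omega v.
Proof.
have [m m0 Om] := bounded_in_box Omega_bounded.
have [Oe|One] := set_empty_or Omega.
  exists 1 => // M adm v _ _; rewrite big1 ?mul1r ?jumps_ge0// => K _.
  by have := center_in_domain adm K; rewrite Oe.
have vO : 0 < vol Omega by exact: vol_gt0 Om _ _.
have [C C0 hC] := linked_domain Omega_open Omega_bounded Omega_connected Omega_polyhedral.
(* C may be 0, while the constant has to be positive. *)
exists ((C + 1) / vol Omega); first by rewrite divr_gt0//; lra.
move=> M adm v pos neg; have S0 := jumps_ge0 Omega v.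
rewrite mulrAC ler_pdivlMr// mulrC.
have KO (K : cell M) : volume K `&` Omega = volume K.
  by apply/setIidPl; exact: (volume_sub adm).
have sumO : \sum_(K : cell M) vol (volume K) = vol Omega.
  apply/eqP; rewrite eq_le; apply/andP; split.
    under eq_bigr do rewrite -KO.
    by apply: (sum_vol_mesh Omega_bounded predT adm Omega_open).
  have := vol_mesh Omega_bounded adm (subset_refl (A := Omega)).
  by under eq_bigr do rewrite KO.
have := hC M adm v; rewrite oscillationE => h.
apply: (@le_trans _ _ (C * jumps Omega v)); last by rewrite ler_wpM2r//; lra.
apply: le_trans h; rewrite -sumO big_distrl /= exchange_big /=.
apply: ler_sum => L _.
apply: (@le_trans _ _ (vol (volume L) * \sum_K vol (volume K) * `|v K - v L|)).
  rewrite ler_wpM2l ?vol_ge0//; apply: median_minimizes sumO pos neg => K.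
  exact: vol_ge0.
rewrite big_distrr /= le_eqVlt; apply/orP; left; apply/eqP.
by apply: eq_bigr => K _; rewrite !KO; ring.
Qed.

(** Translates the measure conditions of a median into conditions on the
    cells. *)
Lemma sum_vol_sub (M : mesh R n.+1)
    (A : set 'rV[R]_n.+1) (P : pred (cell M)) :
  admissible Omega M -> (forall K x, P K -> volume K x -> A x) ->
  (lebesgue (Omega `&` A) <= lebesgue Omega * (2^-1)%R%:E)%E ->
  \sum_(K | P K) vol (volume K) <= vol Omega / 2.
Proof.
move=> adm PA; have [m m0 Om] := bounded_in_box Omega_bounded.
have OAm : in_box m (Omega `&` A) by apply: in_boxS Om => x [].
rewrite (volE OAm) (volE Om) -EFinM lee_fin; apply: le_trans.
pose G := \bigcup_(K in [set K | P K]) volume (m := M) K.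
have oG : open G by apply: bigcup_open => K _; exact: (volume_open adm).
have GO : G `<=` Omega by move=> x [K _ Kx]; exact: (volume_sub adm) Kx.
have KG K : P K -> volume K `&` G = volume K.
  by move=> PK; apply/setIidPl => x Kx; exists K.
apply: (@le_trans _ _ (vol G)); last first.
  by apply: le_vol OAm => x Gx; split; [exact: GO|case: Gx => K PK; exact: PA].
apply: le_trans (sum_vol_mesh Omega_bounded P adm oG GO).
by apply: ler_sum => K PK; rewrite KG.
Qed.

End poincare.

(** * Regular meshes and general p *)

Section regular_mesh.
Context (R : realType) (n : nat) (Omega : set 'rV[R]_n.+1) (M : mesh R n.+1).
Hypotheses (adm : admissible Omega M) (bounded : bounded_set Omega).
Variable xi : R.
Hypotheses (xi_gt0 : 0 < xi) (reg : regular M xi).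

(** Regularity gives d_s <= d(x_K, s) / xi on both sides of s; regrouping by
    cells, [sum_pyramids] bounds the sum over the faces of each cell. *)
Lemma sum_faces_le_volume (a : cell M -> R) : (forall K, 0 <= a K) ->
  \sum_(s : edge M | `[< interior_edge Omega s >])
    (if sides s is Some KL then
       area s * d_edge KL.1 s * (a KL.1 + a KL.2) else 0) <=
  2 ^+ n.+1 / xi * \sum_K vol (volume K) * a K.
Proof.
move=> a0; pose side (s : edge M) K :=
  if sides s is Some KL then (K == KL.1) || (K == KL.2) else false.
have sideP s K : side s K -> exists L, interface s K L.
  rewrite /side; case E : (sides s) => [[K0 L0]|//] /=.
  have KL := sidesP E; case/orP => /eqP ->; first by exists L0.
  by exists K0; exact: interfaceC KL.
apply: (@le_trans _ _ (\sum_(s : edge M) \sum_(K | side s K)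
    a K / xi * (area s * edist (center K) (face s)))).
  rewrite big_mkcond; apply: ler_sum => s _.
  have rhs0 : 0 <= \sum_(K | side s K)
      a K / xi * (area s * edist (center K) (face s)).
    apply: sumr_ge0 => K sK; have [L KL] := sideP _ _ sK.
    have [e [delta [U [_ _ _ _ _]]]] := interface_frame adm KL.
    rewrite !mulr_ge0 ?area_ge0 ?invr_ge0 ?(ltW xi_gt0)//.
    apply: lb_le_inf; first by have [z sz] := face_nonempty adm s;
      exists (enorm (center K - z)), z.
    by move=> _ [y _ <-]; exact: enorm_ge0.
  case: ifP => // _; case E : (sides s) => [[K0 L0]|] //=.
  have KL := sidesP E; have K0L0 : L0 != K0 by rewrite eq_sym; case: KL.
  have s1 : side s K0 by rewrite /side E eqxx.
  have s2 : side s L0 by rewrite /side E eqxx orbT.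
  rewrite (bigD1 K0 s1)/= (bigD1 L0)/=; last by rewrite s2.
  have dE K : d_edge K s = d_edge K0 s by rewrite /d_edge E.
  have le1 K L : interface s K L -> area s * d_edge K0 s * a K <=
      a K / xi * (area s * edist (center K) (face s)).
    move=> /(interface_edge_of adm)/reg; rewrite dE => h.
    have -> : a K / xi * (area s * edist (center K) (face s)) =
        area s * (edist (center K) (face s) / xi) * a K by ring.
    by rewrite ler_wpM2r// ler_wpM2l ?area_ge0// ler_pdivlMr// mulrC.
  rewrite mulrDr lerD//; first exact: le1 KL.
  rewrite big1 ?addr0; first exact: le1 (interfaceC KL).
  move=> K /andP[/andP[]]; rewrite /side E => /orP[/eqP ->|/eqP ->].
    by rewrite eqxx.
  by rewrite eqxx.
rewrite (exchange_big_dep predT)//= big_distrr /=; apply: ler_sum => K _.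
rewrite -big_distrr /=.
apply: (@le_trans _ _ (a K / xi * (2 ^+ n.+1 * vol (volume K)))).
  rewrite ler_wpM2l ?divr_ge0 ?(ltW xi_gt0)//.
  by apply: (sum_pyramids adm bounded) => s; exact: sideP.
by rewrite le_eqVlt; apply/orP; left; apply/eqP; ring.
Qed.

End regular_mesh.

Lemma powRV (R : realType) (x r : R) : 0 <= x -> x^-1 `^ r = (x `^ r)^-1.
Proof. by move=> x0; rewrite -powR_inv1// -powRrM mulN1r powRN. Qed.

Section regular_poincare.
Context (R : realType) (n : nat) (Omega : set 'rV[R]_n.+1) (p : R).
Hypotheses (Omega_open : open Omega) (Omega_bounded : bounded_set Omega).
Hypotheses (Omega_connected : connected Omega).
Hypotheses (Omega_polyhedral : polyhedral Omega) (p_ge1 : 1 <= p).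

(** On the face s = K|L, write |w_K - w_L| = d_s z with z the difference
    quotient, and apply [young_weighted] to |w_K| and z, then to |w_L| and z. *)
Lemma jumps_young (M : mesh R n.+1) (adm : admissible Omega M) (w : cell M -> R)
    (eta : R) : 0 < eta ->
  jumps Omega (fun K => signed_powR p (w K)) <=
  (p - 1) * eta * (\sum_(s : edge M | `[< interior_edge Omega s >])
    (if sides s is Some KL then
       area s * d_edge KL.1 s * (`|w KL.1| `^ p + `|w KL.2| `^ p) else 0)) +
  2 * (eta `^ (p - 1))^-1 * (\sum_(s : edge M | `[< interior_edge Omega s >])
    (if sides s is Some KL then
       area s / d_edge KL.1 s `^ (p - 1) * `|w KL.1 - w KL.2| `^ p else 0)).
Proof.
have p1 := p_ge1; move=> eta0; rewrite !big_distrr -big_split /=; apply: ler_sum => s _.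
case E : (sides s) => [[K L]|] /=; last by rewrite !mulr0 addr0.
set d := d_edge K s; set z := `|w K - w L|; set g := (_ `^ (p - 1))^-1.
have d0 : 0 < d.
  rewrite /d /d_edge E /=; apply: enorm_gt0; rewrite subr_eq0; apply/eqP => KL.
  have [/eqP nKL _] := sidesP E; apply: nKL => /=.
  apply: (volume_disj adm (center_in_volume adm K)).
  by rewrite KL; exact: (center_in_volume adm).
have z0 : 0 <= z by exact: normr_ge0.
have zd : 0 <= z / d by rewrite divr_ge0// ltW.
have dp : d * (z / d) `^ p = z `^ p / d `^ (p - 1).
  have dV0 : 0 <= d^-1 by rewrite invr_ge0 ltW.
  have p0 : 0 < p by lra.
  rewrite (powRM _ z0 dV0) (powRV _ (ltW d0)).
  rewrite -(mulr_powRB1 (ltW d0) p0) invfM mulrCA (mulrA d) divff ?gt_eqF//.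
  by rewrite mul1r.
have yK := young_weighted p_ge1 eta0 (normr_ge0 (w K)) zd.
have yL := young_weighted p_ge1 eta0 (normr_ge0 (w L)) zd.
have := signed_powR_dist (w K) (w L) p_ge1; rewrite -/z => zKL.
apply: (@le_trans _ _ (area s * d * (p * (`|w K| `^ (p - 1) * (z / d)) +
    p * (`|w L| `^ (p - 1) * (z / d))))).
  rewrite -mulrA ler_wpM2l ?area_ge0//; apply: (le_trans zKL).
  rewrite le_eqVlt; apply/orP; left; apply/eqP.
  by field; rewrite gt_eqF.
have ad : 0 <= area s * d by rewrite mulr_ge0 ?area_ge0 ?ltW.
apply: (le_trans (ler_wpM2l ad (lerD yK yL))).
rewrite -/g le_eqVlt; apply/orP; left; apply/eqP.
have -> : area s / d `^ (p - 1) * z `^ p = area s * (z `^ p / d `^ (p - 1)).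
  by ring.
by rewrite -dp; ring.
Qed.

(** The constant k is such that, for eta = xi / k, the first term of
    [jumps_young] contributes at most half of the left-hand side, whatever
    xi. *)
Lemma poincare_power : exists2 C : R, 0 < C &
  forall (M : mesh R n.+1) (xi : R),
    admissible Omega M -> 0 < xi -> regular M xi ->
    forall u : 'rV[R]_n.+1 -> R, piecewise_constant M u ->
    forall c : R, med Omega u c ->
    \sum_(K : cell M) vol (volume K) * `|u (center K) - c| `^ p <=
    C / xi `^ (p - 1) * \sum_(s : edge M | `[< interior_edge Omega s >])
      (if sides s is Some KL then
         area s / d_edge KL.1 s `^ (p - 1) *
         `|u (center KL.1) - u (center KL.2)| `^ p else 0).
Proof.
have p1 := p_ge1.
have [C C0 hC] := poincare_median Omega_open Omega_bounded Omega_connected Omega_polyhedral.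
(* With eta = xi / k, C (p - 1) eta (2^(n+1) / xi) = (p - 1) / (2 p) <= 1 / 2. *)
pose k := 2 * C * p * 2 ^+ n.+1.
have k0 : 0 < k by rewrite !mulr_gt0 ?exprn_gt0//; lra.
exists (4 * C * k `^ (p - 1)); first by rewrite !mulr_gt0 ?powR_gt0.
move=> M xi adm xi0 reg u upc c [med1 med2].
pose w (K : cell M) := u (center K) - c.
pose v K := signed_powR p (w K).
have uE (K : cell M) x : volume K x -> u x = u (center K).
  by move=> Kx; apply: upc Kx _; exact: (center_in_volume adm).
have p0 : 0 < p by lra.
have pos : \sum_(K | 0 < v K) vol (volume K) <= vol Omega / 2.
  apply: (@sum_vol_sub _ _ _ Omega_bounded M [set x | c < u x] _ adm _ med1).
  move=> K x /(signed_powR_gt0 p0) wK Kx.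
  by rewrite /= (uE K)// -subr_gt0.
have neg : \sum_(K | v K < 0) vol (volume K) <= vol Omega / 2.
  apply: (@sum_vol_sub _ _ _ Omega_bounded M [set x | u x < c] _ adm _ med2).
  move=> K x /signed_powR_lt0 wK Kx.
  by rewrite /= (uE K)// -subr_lt0.
have := hC M adm v pos neg.
under eq_bigr do rewrite norm_signed_powR.
set N := \sum_K _; set S := \sum_(s | _) _ => NC.
have N0 : 0 <= N by apply: sumr_ge0 => K _; rewrite mulr_ge0 ?vol_ge0 ?powR_ge0.
pose eta := xi / k; have eta0 : 0 < eta by rewrite divr_gt0.
have := jumps_young adm w eta0; rewrite -/v.
rewrite [X in _ <= _ + _ * X](_ : _ = S); last first.
  apply: eq_bigr => s _; case: sides => // -[K L] /=.
  by rewrite /w; congr (_ * `|_| `^ _); ring.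
have := sum_faces_le_volume adm Omega_bounded xi0 reg (fun K => powR_ge0 `|w K| p).
rewrite -/N; set T := \sum_(s | _) _ => TN JT.
have ek : (eta `^ (p - 1))^-1 = k `^ (p - 1) / xi `^ (p - 1).
  have kV0 : 0 <= k^-1 by rewrite invr_ge0 ltW.
  by rewrite /eta (powRM _ (ltW xi0) kV0) (powRV _ (ltW k0)) invfM invrK mulrC.
rewrite ek in JT.
have absorb : C * ((p - 1) * eta * T) <= N / 2.
  have q0 : 0 < 2 ^+ n.+1 :> R by rewrite exprn_gt0.
  have TN' : C * ((p - 1) * eta * T) <=
      C * ((p - 1) * eta * (2 ^+ n.+1 / xi * N)).
    have ce : 0 <= (p - 1) * eta by rewrite mulr_ge0 ?(ltW eta0)//; lra.
    exact: (ler_wpM2l (ltW C0) (ler_wpM2l ce TN)).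
  apply: (le_trans TN').
  have -> : C * ((p - 1) * eta * (2 ^+ n.+1 / xi * N)) = (p - 1) / (2 * p) * N.
    by rewrite /eta /k; field; rewrite !gt_eqF.
  rewrite (_ : N / 2 = 2^-1 * N); last by rewrite mulrC.
  rewrite ler_wpM2r// ler_pdivrMr; lra.
have : N <= C * ((p - 1) * eta * T + 2 * (k `^ (p - 1) / xi `^ (p - 1)) * S).
  by apply: le_trans NC _; rewrite ler_wpM2l// ltW.
rewrite mulrDr => NE.
have -> : 4 * C * k `^ (p - 1) / xi `^ (p - 1) * S =
   2 * (C * (2 * (k `^ (p - 1) / xi `^ (p - 1)) * S)) by ring.
move: (C * (2 * _ * S)) NE => Z NE; lra.
Qed.

End regular_poincare.

Theorem proposition2p8 (R : realType) (d : nat) (Omega : set 'rV[R]_d) (p : R)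
    (d_ge2 : (2 <= d)%N)
    (Omega_open : open Omega) (Omega_bounded : bounded_set Omega)
    (Omega_connected : connected Omega) (Omega_polyhedral : polyhedral Omega)
    (p_ge1 : 1 <= p) :
  exists2 C : R, 0 < C &
    forall (M : mesh R d) (xi : R),
      admissible Omega M -> 0 < xi -> regular M xi ->
      forall u : 'rV[R]_d -> R, piecewise_constant M u ->
      forall c : R, med Omega u c ->
        norm0 M p (fun x => u x - c) <=
        C / xi `^ ((p - 1) / p) * seminorm1 Omega M p u.
Proof.
case: d d_ge2 Omega Omega_open Omega_bounded Omega_connected Omega_polyhedral => // n _.
move=> Omega oO bO cO pO.
have [C C0 hC] := poincare_power oO bO cO pO p_ge1.
have p0 : 0 < p by lra.
exists (C `^ p^-1); first exact: powR_gt0.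
move=> M xi adm xi0 reg u upc c uc.
have := hC M xi adm xi0 reg u upc c uc.
rewrite /norm0 /seminorm1.
set N := \sum_K _; set S := \sum_(s | _) _ => NS.
have N0 : 0 <= N.
  by apply: sumr_ge0 => K _; rewrite mulr_ge0 ?vol_ge0 ?powR_ge0.
have S0 : 0 <= S.
  apply: sumr_ge0 => s _; case: sides => // KL.
  by rewrite mulr_ge0 ?divr_ge0 ?area_ge0 ?powR_ge0.
have xp0 : 0 < xi `^ (p - 1) by exact: powR_gt0.
have C'0 : 0 <= C / xi `^ (p - 1) by rewrite divr_ge0 ?ltW.
have pV0 : 0 <= p^-1 by rewrite invr_ge0 ltW.
apply: (@le_trans _ _ ((C / xi `^ (p - 1) * S) `^ p^-1)).
  apply: (ge0_ler_powR pV0 _ _ NS); rewrite nnegrE; first exact: N0.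
  exact: mulr_ge0.
have xV0 : 0 <= (xi `^ (p - 1))^-1 by rewrite invr_ge0 ltW.
rewrite (powRM _ C'0 S0) (powRM _ (ltW C0) xV0).
by rewrite (powRV _ (ltW xp0)) -powRrM.
Qed.
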